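(* Let $u_h^{cr}\in \mathcal{S}^{1,cr}_D(\mathcal{T}_h)$ and $z_h^{rt}\in \mathcal{R}T^0_N(\mathcal{T}_h)$ satisfy $$\int_{\Omega}\phi(\nabla_h u_h^{cr})\,dx=\sup_{y_h\in \mathcal{R}T^0_N(\mathcal{T}_h)}\Big\{\int_{\Omega}\nabla_h u_h^{cr}\cdot\Pi_h y_h\,dx-\int_{\Omega}\phi^*(\Pi_h y_h)\,dx\Big\},$$ $$\int_{\Omega}\psi_h^*(\cdot,\mathrm{div}(z_h^{rt}))\,dx=\sup_{v_h\in \mathcal{S}^{1,cr}_D(\mathcal{T}_h)}\Big\{\int_{\Omega}\mathrm{div}(z_h^{rt})\,\Pi_h v_h\,dx-\int_{\Omega}\psi_h(\cdot,\Pi_h v_h)\,dx\Big\}.$$ Then the following statements are equivalent: (i) $I_h^{cr}(u_h^{cr})=D_h^{rt}(z_h^{rt})$. (ii) $(\Pi_h u_h^{cr},z_h^{rt})\in \Pi_h(\mathcal{S}^{1,cr}_D(\mathcal{T}_h))\times \mathcal{R}T^0_N(\mathcal{T}_h)$ is a saddle point of $\overline{L}_h$, i.e., $$\max_{y_h\in \mathcal{R}T^0_N(\mathcal{T}_h)}\overline{L}_h(\Pi_h u_h^{cr},y_h)=\overline{L}_h(\Pi_h u_h^{cr},z_h^{rt})=\min_{v_h\in \mathcal{S}^{1,cr}_D(\mathcal{T}_h)}\overline{L}_h(\Pi_h v_h,z_h^{rt}).$$ Moreover, if (i) or (ii) holds, then almost everywhere in $\Omega$ $$\Pi_h z_h^{rt}\cdot\nabla_h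 u_h^{cr}=\phi^*(\Pi_h z_h^{rt})+\phi(\nabla_h u_h^{cr}),\qquad \mathrm{div}(z_h^{rt})\,\Pi_h u_h^{cr}=\psi_h^*(\cdot,\mathrm{div}(z_h^{rt}))+\psi_h(\cdot,\Pi_h u_h^{cr}).$$
   Context: Domain and mesh: $\Omega\subseteq\mathbb{R}^d$, $d\in\mathbb{N}$, is a bounded polyhedral Lipschitz domain; $\partial\Omega=\Gamma_D\cup\Gamma_N$ is a disjoint union with $\Gamma_D$ closed. $\mathcal{T}_h$ is a shape-regular conforming triangulation of $\Omega$ into simplices with set of sides $\mathcal{S}_h$; each boundary side is contained in $\Gamma_D$ or in the closure of $\Gamma_N$. $x_S$ is the barycenter of a side $S$, $n_T$ the outward unit normal of $T$, $n$ the outward unit normal of $\Omega$, and $[\![\cdot]\!]_S$ the jump across an interior side $S$ (for vector fields $[\![y_h\cdot n]\!]_S=y_h|_{T_+}\cdot n_{T_+}+y_h|_{T_-}\cdot n_{T_-}$, with $T_\pm$ the two elements sharing $S$). Spaces and operators: $\mathcal{L}^k(\mathcal{T}_h)$ denotes functions that are polynomials of degree at most $k$ on each element. $\Pi_h$ is the $L^2$-projection onto element-wise constant functions (or vector fields). $\nabla_h$ is the element-wise gradient. $\mathcal{S}^{1,cr}_D(\mathcal{T}_h)$ (Crouzeix--Raviart space) is the set of $v_h\in\mathcal{L}^1(\mathcal{T}_h)$ with $\int_S[\![v_h]\!]_S\,ds=0$ for every interior side $S$ and $v_h(x_S)=0$ for every side $S\subseteq\Gamma_D$. $\mathcal{R}T^0_N(\mathcal{T}_h)$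 (lowest order Raviart--Thomas space) is the set of $y_h\in\mathcal{L}^1(\mathcal{T}_h)^d$ such that $y_h|_T\cdot n_T$ is constant on each side of $T$ for all $T\in\mathcal{T}_h$, $[\![y_h\cdot n]\!]_S=0$ on every interior side $S$, and $y_h\cdot n=0$ on $\Gamma_N$. Functionals: $\phi:\mathbb{R}^d\to\mathbb{R}\cup\{+\infty\}$ is proper, convex and lower semi-continuous. $\psi_h:\Omega\times\mathbb{R}\to\mathbb{R}\cup\{+\infty\}$ is such that $\psi_h(\cdot,t)$ is element-wise constant with respect to $\mathcal{T}_h$ for all $t\in\mathbb{R}$, and $\psi_h(x,\cdot)$ is proper, convex and lower semi-continuous for almost every $x\in\Omega$. $\phi^*$ and $\psi_h^*$ are the Fenchel conjugates ($\psi_h^*$ with respect to the second argument). Define $$I_h^{cr}(v_h)=\int_\Omega\phi(\nabla_h v_h)\,dx+\int_\Omega\psi_h(\cdot,\Pi_h v_h)\,dx,\qquad v_h\in\mathcal{S}^{1,cr}_D(\mathcal{T}_h),$$ $$D_h^{rt}(y_h)=-\int_\Omega\phi^*(\Pi_h y_h)\,dx-\int_\Omega\psi_h^*(\cdot,\mathrm{div}(y_h))\,dx,\qquad y_h\in\mathcal{R}T^0_N(\mathcal{T}_h),$$ and for $\overline v_h\in\Pi_h(\mathcal{S}^{1,cr}_D(\mathcal{T}_h))$, $y_h\in\mathcal{R}T^0_N(\mathcal{T}_h)$ $$\overline{L}_h(\overline v_h,y_h)=-\int_\Omega\mathrm{div}(y_h)\,\overline v_h\,dx-\int_\Omega\phi^*(\Pi_h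 y_h)\,dx+\int_\Omega\psi_h(\cdot,\overline v_h)\,dx .$$ It is a standing assumption that $\phi$ and $\psi_h$ are such that $I_h^{cr}$ admits a minimizer. *)

(* Defs.v *)
From HB Require Import structures.
From mathcomp Require Import all_boot all_order all_algebra.
From mathcomp Require Import all_classical all_reals all_analysis.
Set Implicit Arguments.
Unset Strict Implicit.
Unset Printing Implicit Defensive.

Import Order.TTheory GRing.Theory Num.Theory numFieldNormedType.Exports.
Local Open Scope classical_set_scope.
Local Open Scope ring_scope.

(* The sigma-algebra on 'rV[R]_n generated by the coordinates (i.e. the Borel
   sets), and Lebesgue measure as the n-fold product of lebesgue_measure. *)
Definition rV_display : measure_display. Proof. exact: default_measure_display. Qed.

Section measurable_rV.
Variables (R : realType) (n : nat).

Definition rV_coord (i : 'I_n) (x : 'rV[R]_n) : measurableTypeR R := x 0 i.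

Let rV0 : g_sigma_preimage rV_coord set0.
Proof. exact: sigma_algebra0. Qed.
Let rVC A : g_sigma_preimage rV_coord A -> g_sigma_preimage rV_coord (~` A).
Proof. exact: sigma_algebraC. Qed.
Let rVU (F : _^nat) : (forall i, g_sigma_preimage rV_coord (F i)) ->
  g_sigma_preimage rV_coord (\bigcup_i (F i)).
Proof. exact: sigma_algebra_bigcup. Qed.

HB.instance Definition _ := @isMeasurable.Build rV_display 'rV[R]_n
  (g_sigma_preimage rV_coord) rV0 rVC rVU.
End measurable_rV.

Lemma measurable_rV_coord (R : realType) n (i : 'I_n) :
  measurable_fun [set: 'rV[R]_n] (rV_coord i).
Proof.
move=> _ Y mY; rewrite setTI; apply: sub_sigma_algebra => /=.
rewrite -bigcup_seq/=; exists i => /=; first by rewrite mem_index_enum.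
by exists Y => //; rewrite setTI.
Qed.

Lemma measurable_fun_rV d (T : measurableType d) (R : realType) n
    (f : T -> 'rV[R]_n) :
  (forall i, measurable_fun [set: T] (rV_coord i \o f)) ->
  measurable_fun [set: T] f.
Proof.
move=> mf _ A mA; rewrite setTI; move: A mA.
pose G := [set A : set 'rV[R]_n | measurable (f @^-1` A)].
have sG : sigma_algebra setT G.
  split => [|A mA|F mF]; rewrite /G/=.
  - by rewrite preimage_set0.
  - by rewrite setTD preimage_setC; apply: measurableC; exact: mA.
  - by rewrite preimage_bigcup; apply: bigcup_measurable => k _; exact: mF.
suff : g_sigma_preimage (@rV_coord R n) `<=` G by [].
apply: smallest_sub => //.
rewrite -bigcup_seq/= => B [i _ [C mC <-]]; rewrite /G /= setTI.
by rewrite -[X in measurable X]setTI; exact: mf.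
Qed.

Section lebesgue_rV.
Variable R : realType.
Local Notation L1 := (@lebesgue_measure R).

Section step.
Variable (n : nat) (mu : {sigma_finite_measure set 'rV[R]_n -> \bar R}).

Definition rV_cons (p : measurableTypeR R * 'rV[R]_n) : 'rV[R]_n.+1 :=
  \row_(i < n.+1) if unlift ord0 i is Some j then p.2 0 j else p.1.

Lemma measurable_rV_cons : measurable_fun setT rV_cons.
Proof.
apply: measurable_fun_rV => i.
rewrite (_ : _ \o _ =
  if unlift ord0 i is Some j then rV_coord j \o snd else fst).
  case: unlift => [j|//].
  apply: measurableT_comp => //; exact: measurable_rV_coord.
by apply/funext => p; rewrite /= /rV_coord mxE; case: unlift.
Qed.

#[local] Hint Extern 0 (measurable_fun _ rV_cons) =>
  exact: measurable_rV_cons : core.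

Definition lebesgue_rV_step : set 'rV[R]_n.+1 -> \bar R :=
  pushforward (L1 \x mu)%E rV_cons.


Let lebesgue_rV_step0 : lebesgue_rV_step set0 = 0%E.
Proof. by rewrite /lebesgue_rV_step /pushforward preimage_set0 measure0. Qed.

Let lebesgue_rV_step_ge0 A : (0 <= lebesgue_rV_step A)%E.
Proof. exact: measure_ge0. Qed.

Let lebesgue_rV_step_sigma_additive : semi_sigma_additive lebesgue_rV_step.
Proof.
exact: measure_semi_sigma_additive.
Qed.

HB.instance Definition _ := isMeasure.Build _ _ _ lebesgue_rV_step
  lebesgue_rV_step0 lebesgue_rV_step_ge0 lebesgue_rV_step_sigma_additive.

Let lebesgue_rV_step_sigma_finite : sigma_finite setT lebesgue_rV_step.
Proof.
have /sigma_finiteP[F [TF ndF Foo]] := sigma_finiteT L1.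
have /sigma_finiteP[G [TG ndG Goo]] := sigma_finiteT mu.
pose g (x : 'rV[R]_n.+1) : measurableTypeR R * 'rV[R]_n :=
  (x 0 ord0, \row_i x 0 (lift ord0 i)).
have gK : cancel rV_cons g.
  move=> [a x]; rewrite /g /rV_cons mxE unlift_none; congr pair.
  by apply/rowP => i; rewrite !mxE liftK.
have mg : measurable_fun setT g.
  apply/measurable_fun_pairP; split; first exact: (measurable_rV_coord ord0).
  apply: measurable_fun_rV => i.
  rewrite (_ : _ \o _ = rV_coord (lift ord0 i)).
    exact: measurable_rV_coord.
  by apply/funext => x; rewrite /= /rV_coord mxE.
exists (fun k => g @^-1` (F k `*` G k)).
  apply/seteqP; split => // x _.
  have [i _ Fi] : (\bigcup_k F k) (g x).1 by rewrite -TF.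
  have [j _ Gj] : (\bigcup_k G k) (g x).2 by rewrite -TG.
  exists (maxn i j) => //; split.
    by move: Fi; exact/subsetPset/ndF/leq_maxl.
  by move: Gj; exact/subsetPset/ndG/leq_maxr.
move=> k; have [mF Fk] := Foo k; have [mG Gk] := Goo k; split.
  by rewrite -[X in measurable X]setTI; apply: mg => //; exact: measurableX.
rewrite /lebesgue_rV_step /pushforward -comp_preimage (_ : g \o _ = id); last first.
  by apply/funext => p /=; rewrite gK.
by rewrite preimage_id product_measure1E// lte_mul_pinfty// ge0_fin_numE.
Qed.

HB.instance Definition _ := Measure_isSigmaFinite.Build _ _ _ lebesgue_rV_step
  lebesgue_rV_step_sigma_finite.
End step.

Fixpoint lebesgue_rV n : {sigma_finite_measure set 'rV[R]_n -> \bar R} :=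
  if n is m.+1 return {sigma_finite_measure set 'rV[R]_n -> \bar R}
  then lebesgue_rV_step (lebesgue_rV m) else \d_(0 : 'rV[R]_0).

Lemma lebesgue_rV_box n (a b : 'rV[R]_n) : (forall i, a 0 i <= b 0 i) ->
  lebesgue_rV n [set x : 'rV[R]_n | forall i, a 0 i <= x 0 i <= b 0 i] =
  (\prod_i (b 0 i - a 0 i))%:E.
Proof.
elim: n a b => [|n IH] a b ab.
  rewrite big_ord0/= diracE mem_set//= => -[].
  by [].
pose tl (x : 'rV[R]_n.+1) : 'rV[R]_n := \row_i x 0 (lift ord0 i).
transitivity ((L1 \x lebesgue_rV n)%E (`[a 0 ord0, b 0 ord0] `*`
    [set x : 'rV[R]_n | forall i, tl a 0 i <= x 0 i <= tl b 0 i])).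
  congr ((L1 \x lebesgue_rV n)%E _).
  apply/seteqP; split => -[t x] /=.
    move=> h; split.
      by have := h ord0; rewrite in_itv /= mxE unlift_none.
    by move=> i; have := h (lift ord0 i); rewrite !mxE liftK.
  move=> [+ h] i; rewrite in_itv /= mxE.
  by case: unliftP => [j ->|->] // _; have := h j; rewrite !mxE.
rewrite product_measure1E//; last first.
  rewrite (_ : [set _ | _] = \bigcap_(i in [set: 'I_n])
     ((rV_coord i) @^-1` `[tl a 0 i, tl b 0 i])).
    apply: fin_bigcap_measurable => // i _.
    by rewrite -[X in measurable X]setTI; exact: measurable_rV_coord.
  apply/seteqP; split => x /= h i.
    by move=> _; rewrite /= in_itv; exact: h.
  by have := h i I; rewrite /= in_itv.
rewrite [X in (X * _)%E](_ : _ = (b 0 ord0 - a 0 ord0)%:E); last first.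
  have := lebesgue_measure_itv `[a 0 ord0, b 0 ord0]; rewrite /= lte_fin => ->.
  case: ltP => h; first by rewrite -EFinB.
  have -> : b 0 ord0 = a 0 ord0 by apply/le_anti; rewrite h ab.
  by rewrite subrr.
rewrite IH; last by move=> i; rewrite !mxE.
by rewrite big_ord_recl -EFinM; under eq_bigr do rewrite !mxE.
Qed.
End lebesgue_rV.
Arguments lebesgue_rV {R} n.

Section convex_analysis.
Variable R : realType.
Local Open Scope ereal_scope.

Definition proper (T : Type) (f : T -> \bar R) :=
  (forall x, f x != -oo) /\ (exists x, f x < +oo).

Definition convex_ereal (E : lmodType R) (f : E -> \bar R) :=
  forall (x y : E) (t : R), (0 <= t <= 1)%R ->
    f (t *: x + (1 - t) *: y)%R <= t%:E * f x + (1 - t)%:E * f y.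

Definition proper_convex_lsc (E : normedModType R) (f : E -> \bar R) :=
  [/\ proper f, convex_ereal f & lower_semicontinuous f].

Definition fenchel_conjugate (E : Type) (pairing : E -> E -> R)
    (f : E -> \bar R) (s : E) : \bar R :=
  ereal_sup [set (pairing s x)%:E - f x | x in [set: E]].

Definition saddle_point (X Y : Type) (A : set X) (B : set Y)
    (L : X -> Y -> \bar R) (x : X) (y : Y) :=
  [/\ A x, B y, (forall y', B y' -> L x y' <= L x y) &
      (forall x', A x' -> L x y <= L x' y)].
End convex_analysis.

Definition dot (R : realType) n (x y : 'rV[R]_n) : R := \sum_i x 0 i * y 0 i.

Definition norm2 (R : realType) n (x : 'rV[R]_n) : R := Num.sqrt (dot x x).

Definition partial (R : realType) n (i : 'I_n) (f : 'rV[R]_n -> R)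
  (x : 'rV[R]_n) : R := 'D_(delta_mx 0 i) f x.

Definition grad (R : realType) n (f : 'rV[R]_n -> R) (x : 'rV[R]_n) :
  'rV[R]_n := \row_i partial i f x.

Definition divergence (R : realType) n (y : 'rV[R]_n -> 'rV[R]_n)
  (x : 'rV[R]_n) : R := \sum_i partial i (fun z => y z 0 i) x.

Definition boundary (T : topologicalType) (A : set T) : set T :=
  closure A `\` A°.

Definition convex_hull (R : realType) n (V : finType) (p : V -> 'rV[R]_n)
    (A : {set V}) : set 'rV[R]_n :=
  [set x | exists c : V -> R, [/\ forall v, 0 <= c v,
     \sum_(v in A) c v = 1 & x = \sum_(v in A) c v *: p v]].

Definition affinely_independent (R : realType) n (V : finType)
    (p : V -> 'rV[R]_n) (A : {set V}) :=
  forall c : V -> R, \sum_(v in A) c v = 0 ->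
    \sum_(v in A) c v *: p v = 0 -> forall v, v \in A -> c v = 0.

Section domain.
Variables (R : realType) (d : nat).
Local Notation E := 'rV[R]_d.
Implicit Type Omega : set E.

Definition bounded_domain Omega :=
  [/\ open Omega, connected Omega, Omega !=set0 & bounded_set Omega].

(* Near each boundary point, Omega is the part on one side of the graph of a
   Lipschitz function: e is the "vertical" direction, and g, being invariant
   along e, is a function of the d-1 coordinates orthogonal to e. *)
Definition lipschitz_boundary Omega :=
  forall x, boundary Omega x ->
    exists (e : E) (g : E -> R) (K : R),
      [/\ norm2 e = 1, (forall y t, g (y + t *: e) = g y), K.-lipschitz g &
          \forall y \near x, Omega y <-> g y < dot y e].

Definition polyhedral Omega :=
  exists (N : nat) (p : 'I_N -> E) (F : {set {set 'I_N}}),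
    closure Omega = \bigcup_(P in [set` F]) convex_hull p P.

Definition polyhedral_lipschitz_domain Omega :=
  [/\ bounded_domain Omega, polyhedral Omega & lipschitz_boundary Omega].
End domain.

(* Elements are given by their sets of vertices. *)
Record mesh (R : realType) (d : nat) := Mesh {
  vertex : finType;
  pos : vertex -> 'rV[R]_d;
  elements : {set {set vertex}} }.
Arguments pos {R d} _ _.

Section mesh_geometry.
Variables (R : realType) (d : nat) (Omega : set 'rV[R]_d) (Th : mesh R d).
Local Notation E := 'rV[R]_d.
Local Notation V := (vertex Th).
Implicit Types T S : {set V}.

Definition hull T : set E := convex_hull (pos Th) T.

Definition conforming_triangulation :=
  [/\ (forall T, T \in elements Th ->
          #|T| = d.+1 /\ affinely_independent (pos Th) T),
      closure Omega = \bigcup_(T in [set` elements Th]) hull T &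
      (forall T T', T \in elements Th -> T' \in elements Th ->
          hull T `&` hull T' = hull (T :&: T'))].

Definition shape_regular (kappa : R) :=
  forall T, T \in elements Th -> exists (x : E) (r : R),
    [/\ 0 < r, (forall y, norm2 (y - x) <= r -> hull T y) &
        (forall y z, hull T y -> hull T z -> norm2 (y - z) <= kappa * r)].

Definition side T S :=
  T \in elements Th /\ (exists2 p, p \in T & S = T :\ p).

Definition boundary_side T S := side T S /\ hull S `<=` boundary Omega.

Definition shared_interior_side T T' S :=
  [/\ side T S, side T' S, T != T' & ~ (hull S `<=` boundary Omega)].

Definition barycenter S : E := #|S|%:R^-1 *: \sum_(v in S) pos Th v.

Definition is_outward_normal T S (n : E) :=
  [/\ norm2 n = 1,
      (forall x y, hull S x -> hull S y -> dot n (y - x) = 0) &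
      (forall x y, hull S x -> hull T y -> dot n (y - x) <= 0)].

Definition outward_normal T S : E := xget 0 (is_outward_normal T S).

(* The value at x in the closed element T of the restriction of f to T. *)
Definition trace T (f : E -> R) (x : E) : R :=
  lim (f @ within (hull T)° (nbhs x)).

Definition normal_trace T S (y : E -> E) (x : E) : R :=
  trace T (fun z => dot (y z) (outward_normal T S)) x.

Definition side_vertex S (i : nat) : E :=
  nth 0 [seq pos Th v | v <- enum S] i.

Definition side_edges S : 'M[R]_(d.-1, d) :=
  \matrix_(i < d.-1) (side_vertex S i.+1 - side_vertex S 0).

Definition reference_simplex n : set 'rV[R]_n :=
  [set t | (forall i, 0 <= t 0 i) /\ \sum_i t 0 i <= 1].

(* Surface integral over the (d-1)-simplex S, through its affine
   parametrisation and Gram determinant. *)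
Definition side_integral S (f : E -> R) : R :=
  Num.sqrt (\det (side_edges S *m (side_edges S)^T)) *
  (\int[lebesgue_rV d.-1]_(t in @reference_simplex d.-1)
      f (side_vertex S 0 + t *m side_edges S)).

Definition boundary_partition (GammaD GammaN : set E) :=
  [/\ boundary Omega = GammaD `|` GammaN, GammaD `&` GammaN = set0,
      closed GammaD &
      (forall T S, boundary_side T S ->
         hull S `<=` GammaD \/ hull S `<=` closure GammaN)].
End mesh_geometry.

Section spaces.
Variables (R : realType) (d : nat) (Omega : set 'rV[R]_d) (Th : mesh R d).
Local Notation E := 'rV[R]_d.
Local Notation mu := (@lebesgue_rV R d).

Definition polynomial_le (k : nat) (p : E -> R) :=
  exists c : {ffun 'I_d -> 'I_k.+1} -> R, forall x,
    p x = \sum_(a : {ffun 'I_d -> 'I_k.+1} | (\sum_i a i <= k)%N)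
            c a * \prod_i x 0 i ^+ a i.

(* Element-wise functions are functions on the whole space of which only the
   values in the interiors of the elements matter, the union of all sides being
   a null set; values on sides are always taken through trace.  For such v and y,
   grad v and divergence y are the element-wise gradient and divergence (for
   Raviart-Thomas fields, the latter is also the weak divergence). *)
Definition pw_polynomial (k : nat) (v : E -> R) :=
  forall T, T \in elements Th -> exists2 p : E -> R, polynomial_le k p &
    forall x, (hull T)° x -> v x = p x.

Definition pw_constant (A : Type) (f : E -> A) :=
  forall T, T \in elements Th ->
    exists c : A, forall x, (hull T)° x -> f x = c.

Definition is_L2_projection (v w : E -> R) :=
  pw_constant w /\ (forall c : E -> R, pw_constant c ->
    \int[mu]_(x in Omega) ((v x - w x) * c x) = 0).

Definition Pi_h (v : E -> R) : E -> R := xget (fun=> 0) (is_L2_projection v).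

Definition Pi_h_vec (y : E -> E) (x : E) : E :=
  \row_i Pi_h (fun z => y z 0 i) x.

Definition crouzeix_raviart (GammaD : set E) (v : E -> R) :=
  [/\ pw_polynomial 1 v,
      (forall T T' S : {set vertex Th}, shared_interior_side Omega T T' S ->
         side_integral S (fun x => trace T v x - trace T' v x) = 0) &
      (forall T S : {set vertex Th}, side T S -> hull S `<=` GammaD ->
         trace T v (barycenter S) = 0)].

(* On a boundary side of T, the outward normal of Omega is that of T. *)
Definition raviart_thomas (GammaN : set E) (y : E -> E) :=
  [/\ (forall i, pw_polynomial 1 (fun x => y x 0 i)),
      (forall T S : {set vertex Th}, side T S -> exists c : R,
         forall x, hull S x -> normal_trace T S y x = c),
      (forall T T' S : {set vertex Th}, shared_interior_side Omega T T' S ->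
         forall x, hull S x ->
           normal_trace T S y x + normal_trace T' S y x = 0) &
      (forall T S : {set vertex Th}, boundary_side Omega T S ->
         forall x, hull S x -> GammaN x -> normal_trace T S y x = 0)].

Section functionals.
Variables (phi : E -> \bar R) (psi : E -> R -> \bar R).
Local Open Scope ereal_scope.

Definition phi_conj : E -> \bar R := fenchel_conjugate (@dot R d) phi.

Definition psi_conj (x : E) : R -> \bar R := fenchel_conjugate *%R (psi x).

Definition I_cr (v : E -> R) : \bar R :=
  (\int[mu]_(x in Omega) phi (grad v x)) +
  (\int[mu]_(x in Omega) psi x (Pi_h v x)).

Definition D_rt (y : E -> E) : \bar R :=
  - (\int[mu]_(x in Omega) phi_conj (Pi_h_vec y x)) -
  (\int[mu]_(x in Omega) psi_conj x (divergence y x)).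

(* If the last two integrals are both +oo, this is -oo (as -oo + +oo = -oo). *)
Definition L_bar (vbar : E -> R) (y : E -> E) : \bar R :=
  - (\int[mu]_(x in Omega) (divergence y x * vbar x)%:E) -
  (\int[mu]_(x in Omega) phi_conj (Pi_h_vec y x)) +
  (\int[mu]_(x in Omega) psi x (vbar x)).
End functionals.
End spaces.

(* Main.v *)
Require Import Defs.
From HB Require Import structures.
From mathcomp Require Import all_boot all_order all_algebra.
From mathcomp Require Import ring lra.
From mathcomp Require Import all_classical all_reals all_analysis.
From mathcomp Require Import measurable_realfun.
Import Order.TTheory GRing.Theory Num.Theory numFieldNormedType.Exports.
Local Open Scope classical_set_scope.
Local Open Scope ring_scope.

Set Implicit Arguments.
Unset Strict Implicit.
Unset Printing Implicit Defensive.

(* All the integrands are constant on the interiors of the elements up to a null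
   set, so every integral is a finite sum weighted by element volumes. Fenchel's
   inequality and the discrete integration by parts
   \int grad_h v . Pi_h y = - \int div y Pi_h v then reduce the equivalence to
   finite-dimensional convex duality: the two hypotheses say that the inner
   supremum and infimum of the Lagrangian at (u, z) are the primal and dual
   energies. They also exclude infinite values: their left-hand sides are never
   -oo, so some y_h has a finite conjugate term and some v_h a finite psi_h term.

   For the integration by parts, in barycentric coordinates lambda_i of an
   element T with opposite sides S_i, a Raviart-Thomas field satisfies
   y . grad lambda_i = c_i - (c_0 + ... + c_d) lambda_i, where c_i is its constant
   value on S_i; hence the integral of div (v y) over T is
   - d |T| \sum_i c_i v(x_{S_i}). Since |T| |grad lambda_S| is the same for the two
   neighbours of an interior side S, their terms cancel. Volumes are compared,
   and the vertices of a simplex exchanged, by maps x + (a.x + b) e, which scale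
   Lebesgue measure by |1 + a.e|. *)

(** * Lebesgue measure under affine dilations *)

(** The definitions pin down little literally: element-wise functions matter only on element
    interiors, [Pi_h] and [outward_normal] are choices among admissible objects, and [phi], [psi]
    may be [+oo]. So each such object first gets an explicit value where it counts, and integrals
    are compared off a null set, which asks for no measurability of compositions with [phi] or its
    conjugate.

    Rank-one perturbations of the identity are the only changes of variables required, since all
    uses are instances: factor 2 makes pieces of hyperplanes null, factor -1 exchanges two vertices,
    and a general factor carries a simplex onto its neighbour.

    The formula for Raviart--Thomas fields has a simple source: y . grad lambda_i is affine and
    equals c_i at every vertex but one, and the value at the last vertex is forced because the
    gradients of the coordinates sum to zero. On an element, y is therefore a constant minus (c_0 +
    ... + c_d) x.

    Extended arithmetic has -oo + +oo = -oo, so finiteness has to be settled before the energies can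
    be rearranged; from (i) it is immediate, from (ii) it takes the two test functions supplied by
    the hypotheses. *)

Section affine1.
Variable R : realType.
Local Notation L1 := (@lebesgue_measure R).

Lemma measurable_affine1 (k c : R) :
  measurable_fun setT ((fun s => k * s + c) : measurableTypeR R -> measurableTypeR R).
Proof.
apply: (@measurable_funD _ _ _ _ (fun s => k * s) (cst c)).
  exact: (@measurable_funM _ _ _ _ (cst k) id).
exact: measurable_cst.
Qed.

(** Uniqueness of Lebesgue measure: [|k|] times the pushforward gives half-open intervals their
    length. *)
Lemma lebesgue_measure_affine (k c : R) (A : set (measurableTypeR R)) :
  k != 0 -> measurable A ->
  L1 ((fun s => k * s + c) @^-1` A) = (`|k|^-1%:E * L1 A)%E.
Proof.
move=> k0 mA; have mf := measurable_affine1 k c.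
pose P : {measure set _ -> \bar R} :=
  measure_function_pushforward__canonical__measure_function_Measure L1 mf.
pose nu : {measure set _ -> \bar R} := mscale (NngNum (normr_ge0 k)) P.
suff -> : L1 A = nu A.
  rewrite /nu /= /mscale /= /pushforward muleA -EFinM mulVf ?mul1e//.
  by rewrite normr_eq0.
apply: lebesgue_measure_unique => // _ [[a b]] _ <-.
rewrite /nu /= /mscale /= /pushforward.
(* A negative [k] exchanges the endpoints and moves the closed end to the left, which does not
   change the length. *)
have key (x : R) : (a < k * x + c <= b) =
  if 0 < k then (a - c) / k < x <= (b - c) / k else (b - c) / k <= x < (a - c) / k.
  case: (ltP 0 k) => k1; first by rewrite ltr_pdivrMr//
    ler_pdivlMr// [x * k]mulrC ltrBlDr lerBrDr.
  have {}k1 : k < 0 by rewrite lt_neqAle k0.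
  by rewrite ltr_ndivlMr// ler_ndivrMr// [x * k]mulrC ltrBlDr lerBrDr andbC.
rewrite lebesgue_measure_itv /= lte_fin.
case: (ltP 0 k) key => k1 key.
  rewrite (_ : _ @^-1` _ = `](a - c) / k, (b - c) / k]%classic); last first.
    by apply/seteqP; split=> x /=; rewrite !in_itv /= key.
  rewrite lebesgue_measure_itv /= lte_fin ltr_pM2r ?invr_gt0// ltrD2r.
  case: ifP => ab; last by rewrite mule0.
  rewrite gtr0_norm// -!EFinB -EFinM; congr EFin; by field.
have {}k1 : k < 0 by rewrite lt_neqAle k0.
rewrite (_ : _ @^-1` _ = `[(b - c) / k, (a - c) / k[%classic); last first.
  by apply/seteqP; split=> x /=; rewrite !in_itv /= key.
rewrite lebesgue_measure_itv /= lte_fin ltr_nM2r ?invr_lt0// ltrD2r.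
case: ifP => ab; last by rewrite mule0.
rewrite ltr0_norm// -!EFinB -EFinM; congr EFin; by field.
Qed.
End affine1.

Section affine_rV.
Variable R : realType.
Local Notation L1 := (@lebesgue_measure R).

Lemma dotDl n (x y z : 'rV[R]_n) : dot (x + y) z = dot x z + dot y z.
Proof. by rewrite /dot -big_split /=; apply: eq_bigr => i _; rewrite mxE mulrDl. Qed.
Lemma dotC n (x y : 'rV[R]_n) : dot x y = dot y x.
Proof. by apply: eq_bigr => i _; rewrite mulrC. Qed.
Lemma dotDr n (x y z : 'rV[R]_n) : dot x (y + z) = dot x y + dot x z.
Proof. by rewrite dotC dotDl !(dotC x). Qed.
Lemma dotZl n (k : R) (x y : 'rV[R]_n) : dot (k *: x) y = k * dot x y.
Proof. by rewrite /dot mulr_sumr; apply: eq_bigr => i _; rewrite mxE mulrA. Qed.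
Lemma dotZr n (k : R) (x y : 'rV[R]_n) : dot x (k *: y) = k * dot x y.
Proof. by rewrite dotC dotZl dotC. Qed.
Lemma dotNl n (x y : 'rV[R]_n) : dot (- x) y = - dot x y.
Proof. by rewrite -scaleN1r dotZl mulN1r. Qed.
Lemma dotNr n (x y : 'rV[R]_n) : dot x (- y) = - dot x y.
Proof. by rewrite dotC dotNl dotC. Qed.
Lemma dotBl n (x y z : 'rV[R]_n) : dot (x - y) z = dot x z - dot y z.
Proof. by rewrite dotDl dotNl. Qed.
Lemma dotBr n (x y z : 'rV[R]_n) : dot x (y - z) = dot x y - dot x z.
Proof. by rewrite dotDr dotNr. Qed.
Lemma dot0l n (x : 'rV[R]_n) : dot 0 x = 0.
Proof. by rewrite -(scale0r 0) dotZl mul0r. Qed.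
Lemma dot0r n (x : 'rV[R]_n) : dot x 0 = 0.
Proof. by rewrite dotC dot0l. Qed.
Lemma dot_suml n (I : Type) (r : seq I) (P : pred I) (F : I -> 'rV[R]_n) y :
  dot (\sum_(i <- r | P i) F i) y = \sum_(i <- r | P i) dot (F i) y.
Proof. by elim/big_ind2: _ => [|? ? ? ? <- <-|//]; rewrite ?dot0l ?dotDl. Qed.
Lemma dot_sumr n (I : Type) (r : seq I) (P : pred I) (F : I -> 'rV[R]_n) y :
  dot y (\sum_(i <- r | P i) F i) = \sum_(i <- r | P i) dot y (F i).
Proof. by rewrite dotC dot_suml; apply: eq_bigr => i _; rewrite dotC. Qed.
Lemma dot_delta n (x : 'rV[R]_n) i : dot x (delta_mx 0 i) = x 0 i.
Proof.
rewrite /dot (bigD1 i)//= mxE !eqxx mulr1 big1 ?addr0// => j ji.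
by rewrite mxE (negPf ji) andbF mulr0.
Qed.

Lemma dot_ge0 n (x : 'rV[R]_n) : 0 <= dot x x.
Proof. by apply: sumr_ge0 => i _; rewrite -expr2 sqr_ge0. Qed.
Lemma dot_gt0 n (x y : 'rV[R]_n) : dot x y != 0 -> 0 < dot x x.
Proof.
move=> xy; rewrite lt_neqAle dot_ge0 andbT eq_sym; apply: contraNneq xy => /eqP.
rewrite psumr_eq0 => [/allP x0|i _]; last by rewrite -expr2 sqr_ge0.
rewrite /dot big1// => i _.
by have := x0 i (mem_index_enum i); rewrite mulf_eq0 orbb => /eqP ->; rewrite mul0r.
Qed.

Lemma measurable_dot_affine n (a : 'rV[R]_n) b :
  measurable_fun setT (fun x : 'rV[R]_n => dot a x + b).
Proof.
apply: measurable_funD => //.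
apply: measurable_sum => i.
apply: measurable_funM => //.
exact: measurable_rV_coord.
Qed.

(** The linear part is the identity plus a rank-one map, with determinant [1 + dot a e]. Shears
    ([dot a e = 0]) and affine reflections ([dot a e = -2]) are included. *)
Definition dilation n (a e : 'rV[R]_n) (b : R) (x : 'rV[R]_n) : 'rV[R]_n :=
  x + (dot a x + b) *: e.

Lemma measurable_dilation n (a e : 'rV[R]_n) b :
  measurable_fun setT (dilation a e b).
Proof.
apply: measurable_fun_rV => i.
rewrite (_ : _ \o _ = fun x => dot (delta_mx 0 i + e 0 i *: a) x + e 0 i * b).
  exact: measurable_dot_affine.
apply/funext => x /=; rewrite /rV_coord /dilation !mxE
  dotDl dotZl [dot (delta_mx _ _) _]dotC dot_delta.
by ring.
Qed.

Lemma measurable_preimage_dilation n (a e : 'rV[R]_n) b (A : set 'rV[R]_n) :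
  measurable A -> measurable (dilation a e b @^-1` A).
Proof.
by move=> mA; rewrite -[X in measurable X]setTI; exact: measurable_dilation.
Qed.

(** Induction along the product construction of the measure. If [i] is not the first coordinate,
    freezing the first one leaves a dilation of the same kind in one dimension less, with a shifted
    constant. *)
Lemma lebesgue_rV_dilation_coord n (i : 'I_n) (a : 'rV[R]_n) (b : R)
    (A : set 'rV[R]_n) :
  1 + a 0 i != 0 -> measurable A ->
  lebesgue_rV n (dilation a (delta_mx 0 i) b @^-1` A) =
  (`|1 + a 0 i|^-1%:E * lebesgue_rV n A)%E.
Proof.
elim: n i a b A => [[//]|n IH] i a b A k0 mA.
set F := dilation _ _ _.
have mcons (B : set 'rV[R]_n.+1) : measurable B -> measurable (@rV_cons R n @^-1` B).
  by move=> mB; rewrite -[X in measurable X]setTI; exact: measurable_rV_cons.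
have AE u v : u = v -> A u -> A v by move->.
have mFA : measurable (F @^-1` A) by exact: measurable_preimage_dilation.
pose a' : 'rV[R]_n := \row_j a 0 (lift ord0 j).
have dotE t (x : 'rV[R]_n) : dot a (rV_cons (t, x)) = a 0 ord0 * t + dot a' x.
  rewrite /dot big_ord_recl; congr (_ + _); first by rewrite mxE unlift_none.
  by apply: eq_bigr => j _; rewrite !mxE liftK.
rewrite /= /lebesgue_rV_step /pushforward.
case: (unliftP ord0 i) => [j ij|i0].
  have secE t : xsection (@rV_cons R n @^-1` (F @^-1` A)) t =
      dilation a' (delta_mx 0 j) (a 0 ord0 * t + b) @^-1`
        xsection (@rV_cons R n @^-1` A) t.
    apply/seteqP; split => x /=; rewrite /xsection /= !inE /= /F
      /dilation dotE; refine (AE _ _ _);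
      apply/rowP => l; rewrite !mxE /=; case: (unliftP ord0 l) => [m ->|->];
         rewrite ?mxE ?ij ?eqxx ?(inj_eq lift_inj)/=; ring.
  rewrite [LHS]/product_measure1.
  under eq_integral => t _.
    rewrite /comp secE IH; last 2 first.
      by rewrite mxE -ij.
      by apply: measurable_xsection; exact: mcons.
    over.
  rewrite mxE -ij ge0_integralZl//.
  by apply: measurable_fun_xsection; exact: mcons.
(* Now the first coordinate itself is scaled, so the product is sliced in the other order: with the
   remaining coordinates frozen, the map is affine on the line. *)
pose P := (L1 \x lebesgue_rV n)%E.
have PE X : measurable X -> P X = (L1 \x^ lebesgue_rV n)%E X.
  move=> mX; apply: product_measure_unique => //= B C mB mC.
  exact: product_measure2E.
rewrite -/P !PE; [|exact: mcons|exact: mcons].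
have secE x : ysection (@rV_cons R n @^-1` (F @^-1` A)) x =
    (fun s => (1 + a 0 i) * s + (dot a' x + b)) @^-1`
      ysection (@rV_cons R n @^-1` A) x.
  apply/seteqP; split => t /=; rewrite /ysection /= !inE /= /F
      /dilation dotE; refine (AE _ _ _);
      apply/rowP => l; rewrite !mxE /=; case: (unliftP ord0 l) => [m ->|->];
       rewrite ?mxE ?i0 ?eqxx ?[_ == ord0]eq_sym ?(negPf (neq_lift _ _)) /=; ring.
rewrite [LHS]/product_measure2.
under eq_integral => x _.
  rewrite /comp secE lebesgue_measure_affine//; last first.
    by apply: measurable_ysection; exact: mcons.
  over.
rewrite ge0_integralZl//.
by apply: measurable_fun_ysection; exact: mcons.
Qed.

End affine_rV.

Section dilation.
Variable R : realType.

Lemma dilationZ n (a : 'rV[R]_n) k e b :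
  dilation a (k *: e) b = dilation (k *: a) e (k * b).
Proof.
by apply/funext => x; rewrite /dilation scalerA dotZl -mulrDr [k * _]mulrC.
Qed.

Lemma rV_eq_delta n (e : 'rV[R]_n) i : (forall j, j != i -> e 0 j = 0) ->
  e = e 0 i *: delta_mx 0 i.
Proof.
move=> ei; apply/rowP => j; rewrite !mxE eqxx /=.
by case: (eqVneq j i) => [->|/ei ->]; rewrite ?mulr1 ?mulr0.
Qed.

(** Induction on the number of nonzero entries of [e]: a measure-preserving shear conjugates the map
    to one whose direction has one nonzero entry fewer, until a coordinate direction or the identity
    remains. *)
Lemma lebesgue_rV_dilation n (a e : 'rV[R]_n) b (A : set 'rV[R]_n) :
  1 + dot a e != 0 -> measurable A ->
  lebesgue_rV n (dilation a e b @^-1` A) =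
  (`|1 + dot a e|^-1%:E * lebesgue_rV n A)%E.
Proof.
have [m] := ubnP #|[pred i | e 0 i != 0]|.
elim: m a e b A => // m IH a e b A cm k0 mA.
have [[i [j [ij ei ej]]]|small] := pselect (exists i j, [/\ j != i, e 0 i != 0 & e 0 j != 0]).
  (* The choices make [G] send [e'] to [e] and give [dot a' x = dot a (G x)]; hence the intertwining
     relation [FG], and [dot a' e' = dot a e]. *)
  pose s := e 0 j / e 0 i.
  pose e' := e - e 0 j *: delta_mx 0 j.
  pose a' := a + (s * a 0 j) *: delta_mx 0 i.
  pose G : 'rV[R]_n -> 'rV[R]_n := dilation (s *: delta_mx 0 i) (delta_mx 0 j) 0.
  have e'i : e' 0 i = e 0 i by rewrite !mxE [_ == j]eq_sym (negPf ij) andbF mulr0 subr0.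
  have GE x : G x = x + (s * x 0 i) *: delta_mx 0 j.
    by rewrite /G /dilation dotZl dotC dot_delta addr0.
  have mG B : measurable B -> lebesgue_rV n (G @^-1` B) = lebesgue_rV n B.
    move=> mB; rewrite lebesgue_rV_dilation_coord
      ?mxE ?eqxx ?(negPf ij) ?mulr0 ?addr0 ?oner_neq0//.
    by rewrite normr1 invr1 mul1e.
  have se : s * e 0 i = e 0 j by rewrite /s mulfVK.
  have ae : dot a' e' = dot a e.
    rewrite /a' dotDl dotZl [dot (delta_mx _ _) _]dotC dot_delta e'i /e'.
    rewrite dotBr dotZr dot_delta mulrAC se; ring.
  have FG : dilation a e b \o G = G \o dilation a' e' b.
    apply/funext => x /=.
    rewrite [in RHS]GE [in LHS]GE.
    have -> : dilation a' e' b x 0 i = x 0 i + (dot a' x + b) * e 0 i.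
      by rewrite /dilation mxE [X in _ + X]mxE e'i.
    rewrite /dilation /a' dotDl dotZl [dot (delta_mx _ _) _]dotC dot_delta.
    rewrite dotDr dotZr dot_delta.
    set t := dot a x + s * x 0 i * a 0 j + b.
    have -> : dot a x + s * a 0 j * x 0 i + b = t by rewrite /t; ring.
    rewrite /e' scalerBr scalerA mulrDr [s * (t * _)]mulrCA se scalerDl.
    by rewrite !addrA; apply/rowP => l; rewrite !mxE; ring.
  rewrite -mG; last exact: measurable_preimage_dilation.
  rewrite -comp_preimage FG comp_preimage IH ?ae//.
  - by rewrite mG.
  - rewrite -ltnS; apply: leq_trans cm; rewrite ltnS; apply: proper_card.
    apply/properP; split; last first.
      by exists j; rewrite !inE ?mxE ?eqxx ?mulr1 ?subrr ?eqxx.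
    apply/fintype.subsetP => l; rewrite !inE !mxE eqxx /=; apply: contra => /eqP l0.
    by case: (eqVneq l j) l0 => [<- ->|_ ->]; rewrite ?mul0r ?mulr0 subr0.
  - exact: measurable_preimage_dilation.
have [[i ei]|e0] := pselect (exists i, e 0 i != 0).
  have eE : e = e 0 i *: delta_mx 0 i.
    apply: rV_eq_delta => j ji; apply/eqP; apply: contra_notT small => ej.
    by exists i, j.
  have aeE : (e 0 i *: a) 0 i = dot a e by rewrite eE dotZr dot_delta !mxE !eqxx mulr1.
  rewrite eE dilationZ lebesgue_rV_dilation_coord//.
    by rewrite -eE aeE.
  by rewrite aeE.
have {}e0 : e = 0.
  apply/rowP => i; rewrite mxE; apply/eqP; apply: contra_notT e0 => ei.
  by exists i.
rewrite e0 dot0r addr0 normr1 invr1 mul1e; congr (lebesgue_rV n _).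
by apply/seteqP; split => x; rewrite /= /dilation scaler0 addr0.
Qed.

(** With [dot a e = 1] the dilation doubles the value of [dot a x + b], so it fixes the hyperplane
    pointwise and [A] is its own preimage, while measures are halved. A finite number equal to its
    half is zero. *)
Lemma lebesgue_rV_hyperplane n (a e : 'rV[R]_n) b (A : set 'rV[R]_n) :
  dot a e = 1 -> measurable A -> A `<=` [set x | dot a x + b = 0] ->
  (lebesgue_rV n A < +oo)%E -> lebesgue_rV n A = 0%E.
Proof.
move=> ae mA AH Aoo.
have := @lebesgue_rV_dilation n a e b A; rewrite ae.
have -> : dilation a e b @^-1` A = A.
  apply/seteqP; split => x /=.
    move=> Fx; have /= := AH _ Fx.
    rewrite {1}/dilation dotDr dotZr ae mulr1 => h.
    have {}h : dot a x + b = 0 by lra.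
    by move: Fx; rewrite /dilation h scale0r addr0.
  by move=> Ax; rewrite /dilation (AH _ Ax) scale0r addr0.
have -> : 1 + 1 = 2%:R :> R by [].
rewrite pnatr_eq0 => /(_ isT mA); rewrite normr_nat.
have : lebesgue_rV n A \is a fin_num by rewrite ge0_fin_numE.
move/fineK => <-; rewrite -EFinM => -[h]; congr EFin.
move: h; lra.
Qed.
End dilation.

(** * Barycentric coordinates *)

Section barycentric.
Variables (R : realType) (n : nat) (I : finType).
Local Notation E := 'rV[R]_n.
Local Notation mu := (@lebesgue_rV R n).

(** An affine function is carried as the pair of its gradient and its value at 0, so the gradient is
    [l.1] and no derivative is taken. *)
Definition affine (l : E * R) (x : E) : R := dot l.1 x + l.2.

Lemma measurable_affine l : measurable_fun setT (affine l).
Proof. exact: measurable_dot_affine. Qed.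

Lemma affine_comb (l : E * R) (A : {set I}) (c : I -> R) (q : I -> E) :
  \sum_(i in A) c i = 1 ->
  affine l (\sum_(i in A) c i *: q i) = \sum_(i in A) c i * affine l (q i).
Proof.
move=> c1; rewrite {1}/affine dot_sumr -[l.2]mul1r -c1 mulr_suml -big_split /=.
by apply: eq_bigr => i _; rewrite dotZr -mulrDr.
Qed.

Lemma affineD l x w : affine l (x + w) = affine l x + dot l.1 w.
Proof. by rewrite /affine dotDr; ring. Qed.

Lemma affineB l x y : affine l x - affine l y = dot l.1 (x - y).
Proof. by rewrite /affine dotBr; ring. Qed.

Variables (A : {set I}) (q : I -> E).

(** Partition of unity, reproduction of points and duality with the vertices are the only facts used
    later; stating them for any index set covers both mesh elements and the reference simplex. *)
Definition barycentric (L : I -> E * R) :=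
  [/\ forall x, \sum_(i in A) affine (L i) x = 1,
      forall x, \sum_(i in A) affine (L i) x *: q i = x &
      forall i j, i \in A -> j \in A -> affine (L i) (q j) = (i == j)%:R].

Definition centroid : E := #|A|%:R^-1 *: \sum_(i in A) q i.

Lemma affine_centroid l : (0 < #|A|)%N ->
  affine l centroid = #|A|%:R^-1 * \sum_(i in A) affine l (q i).
Proof.
move=> A0; rewrite /centroid scaler_sumr affine_comb -?mulr_sumr//.
by rewrite sumr_const -[_ *+ _]mulr_natr mulVf// pnatr_eq0 -lt0n.
Qed.

(** The parameter [P] lets the closed simplex ([[0, +oo[]) and its interior ([]0, +oo[]) share one
    computation of measure and integrals. *)
Definition bary_region (L : I -> E * R) (P : set R) : set E :=
  [set x | forall i, i \in A -> P (affine (L i) x)].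

Lemma measurable_bary_region L P : measurable P -> measurable (bary_region L P).
Proof.
move=> mP; rewrite (_ : bary_region L P =
    \bigcap_(i in [set i | i \in A]) (affine (L i) @^-1` P)).
  apply: fin_bigcap_measurable => // i _.
  by rewrite -[X in measurable X]setTI; exact: measurable_affine.
by apply/seteqP; split => x /= h i iA; exact: h.
Qed.

Variables (L : I -> E * R) (LP : barycentric L).

Lemma bary_coeff (c : I -> R) : \sum_(i in A) c i = 1 ->
  forall i, i \in A -> affine (L i) (\sum_(j in A) c j *: q j) = c i.
Proof.
case: LP => _ _ Lq c1 i iA; rewrite affine_comb// (bigD1 i)//= Lq// eqxx mulr1.
by rewrite big1 ?addr0// => j /andP[jA ji]; rewrite Lq// eq_sym (negPf ji) mulr0.
Qed.

Lemma affine_bary l x :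
  affine l x = \sum_(i in A) affine (L i) x * affine l (q i).
Proof. by case: LP => L1 Lx _; rewrite -{1}(Lx x) affine_comb. Qed.

Lemma bary_grad_sum w : \sum_(i in A) dot (L i).1 w = 0.
Proof.
have [L1 _ _] := LP; have := L1 w; rewrite -(L1 0) => /eqP; rewrite -subr_eq0 -sumrB.
by move=> /eqP h; rewrite -[RHS]h; apply: eq_bigr => i _; rewrite affineB subr0.
Qed.

Lemma bary_grad_decomp w : \sum_(i in A) dot (L i).1 w *: q i = w.
Proof.
have [_ Lx _] := LP; rewrite -[RHS]subr0 -{2}(Lx 0) -{2}(Lx w) -sumrB.
by apply: eq_bigr => i _; rewrite -scalerBl affineB subr0.
Qed.

(** [bary_grad_decomp] writes the identity as a sum of rank-one maps; this is its trace. *)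
Lemma bary_grad_trace : \sum_(i in A) dot (L i).1 (q i) = n%:R.
Proof.
under eq_bigr do rewrite /dot.
rewrite exchange_big /=; transitivity (\sum_(k < n) (1 : R)); last first.
  by rewrite sumr_const card_ord.
apply: eq_bigr => k _.
have /(congr1 (fun x : E => x 0 k)) := bary_grad_decomp (delta_mx 0 k).
rewrite summxE mxE !eqxx /= => h; rewrite -[RHS]h.
by apply: eq_bigr => i _; rewrite mxE dot_delta.
Qed.

Lemma bary_grad_diff i j k : i \in A -> j \in A -> k \in A ->
  dot (L i).1 (q j - q k) = (i == j)%:R - (i == k)%:R.
Proof. by case: LP => _ _ Lq iA jA kA; rewrite -affineB !Lq. Qed.

Lemma card_bary_gt0 : (0 < #|A|)%N.
Proof.
case: LP => L1 _ _; rewrite lt0n; apply: contra_eq_neq (L1 0) => /eqP.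
rewrite cards_eq0 => /eqP ->.
by rewrite big_set0 eq_sym oner_neq0.
Qed.

Lemma bary_centroid i : i \in A -> affine (L i) centroid = #|A|%:R^-1.
Proof.
case: LP => _ _ Lq iA; rewrite affine_centroid ?card_bary_gt0// (bigD1 i)//= Lq// eqxx.
by rewrite big1 ?addr0 ?mulr1// => j /andP[jA ji]; rewrite Lq// eq_sym (negPf ji).
Qed.

Variable P : set R.
Hypotheses (mP : measurable P) (P0 : P `<=` [set t | 0 <= t]).
Local Notation K := (bary_region L P).

Lemma bary_region_le1 x i : K x -> i \in A -> 0 <= affine (L i) x <= 1.
Proof.
move=> Kx iA; case: LP => L1 _ _; rewrite (P0 (Kx i iA)) /= -(L1 x) (bigD1 i)//=.
rewrite lerDl; apply: sumr_ge0 => j /andP[jA _]; exact: P0 (Kx j jA).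
Qed.

Lemma measurable_box (a b : E) :
  measurable [set x : E | forall i, a 0 i <= x 0 i <= b 0 i].
Proof.
rewrite (_ : [set _ | _] = \bigcap_(i in [set: 'I_n])
     ((@rV_coord R n i) @^-1` `[a 0 i, b 0 i])).
  apply: fin_bigcap_measurable => // i _.
  by rewrite -[X in measurable X]setTI; exact: measurable_rV_coord.
apply/seteqP; split => x /= h i.
  by move=> _; rewrite /= in_itv; exact: h.
by have := h i Logic.I; rewrite /= in_itv.
Qed.

Lemma bary_region_fin : (mu K < +oo)%E.
Proof.
pose M : E := \row_k \sum_(i in A) `|q i 0 k|.
have M0 k : 0 <= M 0 k by rewrite mxE sumr_ge0.
have sub : K `<=` [set x : E | forall k, (- M) 0 k <= x 0 k <= M 0 k].
  move=> x Kx k; rewrite [(- M) 0 k]mxE -ler_norml.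
  have [_ Lx _] := LP; rewrite -(Lx x) summxE mxE.
  apply: le_trans (ler_norm_sum _ _ _) _; apply: ler_sum => i iA.
  have /andP[l0 l1] := bary_region_le1 Kx iA.
  by rewrite mxE normrM ger0_norm// ler_piMl.
apply: (@le_lt_trans _ _ (mu [set x : E | forall k, (- M) 0 k <= x 0 k <= M 0 k])).
  by apply: le_measure => //; rewrite inE;
    [exact: measurable_bary_region|exact: measurable_box].
rewrite lebesgue_rV_box ?ltry// => k.
by rewrite mxE (le_trans _ (M0 k))// oppr_le0.
Qed.

Lemma bary_region_gt0 : [set t | 0 < t] `<=` P -> (0 < mu K)%E.
Proof.
move=> Ppos; have N0 : 0 < #|A|%:R :> R by rewrite ltr0n card_bary_gt0.
pose M := \sum_(i in A) \sum_(k < n) `|(L i).1 0 k|.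
have M0 : 0 <= M by rewrite sumr_ge0// => i _; rewrite sumr_ge0.
have M1 : 0 < M + 1 by lra.
(* [M] bounds the l1-norm of each gradient, so within [eps] of the centroid a coordinate drops by at
   most [M * eps], less than its central value [#|A|%:R^-1]. The [+ 1] avoids dividing by zero. *)
pose eps := #|A|%:R^-1 / (M + 1).
have e0 : 0 < eps by rewrite divr_gt0// invr_gt0.
pose a : E := centroid - const_mx eps.
pose b : E := centroid + const_mx eps.
have sub : [set x : E | forall k, a 0 k <= x 0 k <= b 0 k] `<=` K.
  move=> x abx i iA; apply: Ppos => /=.
  rewrite -(subrK centroid x) addrC affineD bary_centroid//.
  have : `|dot (L i).1 (x - centroid)| <= M * eps.
    apply: le_trans (ler_norm_sum _ _ _) _.
    rewrite /M (bigD1 i)//= mulrDl -[leLHS]addr0 lerD//; last first.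
      by rewrite mulr_ge0 ?(ltW e0)// sumr_ge0// => j _; rewrite sumr_ge0.
    rewrite mulr_suml; apply: ler_sum => k _; rewrite normrM ler_wpM2l//.
    by have := abx k; rewrite !mxE ler_distl.
  rewrite ler_norml => /andP[h _].
  have : M * eps < #|A|%:R^-1.
    by rewrite /eps mulrCA gtr_pMr ?invr_gt0// ltr_pdivrMr// mul1r ltrDl.
  lra.
apply: (@lt_le_trans _ _ (mu [set x : E | forall k, a 0 k <= x 0 k <= b 0 k])).
  rewrite lebesgue_rV_box; last by move=> k; rewrite !mxE; lra.
  by rewrite lte_fin prodr_gt0// => k _; rewrite !mxE; lra.
by apply: le_measure => //; rewrite inE; [exact: measurable_box|exact: measurable_bary_region].
Qed.

(* The dilation exchanges the vertices [q i] and [q j], hence preserves the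
   measure. *)
Lemma integral_bary_swap i j : i \in A -> j \in A ->
  (\int[mu]_(x in K) (affine (L i) x)%:E = \int[mu]_(x in K) (affine (L j) x)%:E)%E.
Proof.
move=> iA jA; have [->//|ij] := eqVneq i j.
have [_ _ Lq] := LP.
pose F := dilation ((L i).1 - (L j).1) (q j - q i) ((L i).2 - (L j).2).
have LF l x : l \in A -> affine (L l) (F x) =
    affine (L l) x + (affine (L i) x - affine (L j) x) * ((l == j)%:R - (l == i)%:R).
  move=> lA; rewrite /F /dilation affineD dotZr bary_grad_diff//; congr (_ + _ * _).
  by rewrite /affine dotBl; ring.
have Fi x : affine (L i) (F x) = affine (L j) x.
  by rewrite LF// eqxx (negPf ij) /=; ring.
have Fj x : affine (L j) (F x) = affine (L i) x.
  by rewrite LF// eqxx [j == i]eq_sym (negPf ij) /=; ring.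
have FK : F @^-1` K = K.
  apply/seteqP; split => x /= Kx l lA; have := Kx l lA.
    case: (eqVneq l i) => [->|li]; first by rewrite -(Fj x) => _; exact: Kx.
    case: (eqVneq l j) => [->|lj]; first by rewrite -(Fi x) => _; exact: Kx.
    by rewrite LF// (negPf li) (negPf lj) subrr mulr0 addr0.
  case: (eqVneq l i) => [->|li]; first by rewrite Fi => _; exact: Kx.
  case: (eqVneq l j) => [->|lj]; first by rewrite Fj => _; exact: Kx.
  by rewrite LF// (negPf li) (negPf lj) subrr mulr0 addr0.
have mF : measurable_fun setT F by exact: measurable_dilation.
have muF B : measurable B -> mu (F @^-1` B) = mu B.
  have k1 : 1 + dot ((L i).1 - (L j).1) (q j - q i) = -1.
    by rewrite dotBl !bary_grad_diff// !eqxx [j == i]eq_sym (negPf ij) /=; ring.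
  have := @lebesgue_rV_dilation R n ((L i).1 - (L j).1) (q j - q i) ((L i).2 - (L j).2) B.
  by rewrite k1 oppr_eq0 oner_eq0 normrN1 invr1 mul1e; apply.
pose nu : {measure set E -> \bar R} :=
  measure_function_pushforward__canonical__measure_function_Measure mu mF.
rewrite [RHS](@eq_measure_integral _ _ _ _ nu)/=; last first.
  by move=> B mB _; rewrite /nu /= /pushforward muF.
rewrite /nu /= ge0_integral_pushforward//=.
- by rewrite FK; apply: eq_integral => x _; rewrite Fj.
- exact: measurable_bary_region.
- by apply/measurable_EFinP; apply: measurable_funTS; exact: measurable_affine.
- by move=> x /[!inE] Kx; rewrite lee_fin; case/andP: (bary_region_le1 Kx jA).
Qed.

Lemma integrable_affine l : mu.-integrable K (EFin \o affine l).
Proof.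
apply: measurable_bounded_integrable => //=.
- exact: measurable_bary_region.
- exact: bary_region_fin.
- by apply: measurable_funTS; exact: measurable_affine.
exists (\sum_(i in A) `|affine l (q i)|); split; first exact: num_real.
move=> M MM x Kx; apply: le_trans (ltW MM); rewrite affine_bary.
apply: le_trans (ler_norm_sum _ _ _) _; apply: ler_sum => i iA.
have /andP[l0 l1] := bary_region_le1 Kx iA.
by rewrite normrM ger0_norm// ler_piMl.
Qed.

(** Centroid rule: by the vertex exchange all barycentric coordinates have the same integral, and
    they sum to 1, so each integral is [mu K] divided by [#|A|]; then [l] is expanded in these
    coordinates. *)
Lemma integral_affine l :
  (\int[mu]_(x in K) (affine l x)%:E = (affine l centroid)%:E * mu K)%E.
Proof.
have mK : measurable K by exact: measurable_bary_region.
have [i0 i0A] : exists i, i \in A by apply/card_gt0P; exact: card_bary_gt0.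
have Kfin : mu K \is a fin_num by rewrite ge0_fin_numE// bary_region_fin.
have N0 : #|A|%:R != 0 :> R by rewrite pnatr_eq0 -lt0n card_bary_gt0.
pose s := fine (\int[mu]_(x in K) (affine (L i0) x)%:E)%E.
have sE i : i \in A -> (\int[mu]_(x in K) (affine (L i) x)%:E = s%:E)%E.
  move=> iA; rewrite fineK; first exact: integral_bary_swap.
  by apply: integrable_fin_num => //; exact: integrable_affine.
have intE (f : I -> R) :
    (\int[mu]_(x in K) (\sum_(i in A) affine (L i) x * f i)%:E =
     (\sum_(i in A) s * f i)%:E)%E.
  under eq_integral do rewrite -sumEFin; under eq_integral do under eq_bigr do rewrite EFinM.
  rewrite integral_sum//=; last first.
    by move=> i; apply: integrableZr => //; exact: integrable_affine.
  rewrite -sumEFin; apply: eq_bigr => i iA.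
  by rewrite integralZr ?sE//; exact: integrable_affine.
(* All weights equal to 1 identify the common value [s] through [mu K]. *)
have := intE (fun=> 1); rewrite (eq_integral (cst 1%E)); last first.
  move=> x _; under eq_bigr do rewrite mulr1.
  by have [-> _ _] := LP.
rewrite integral_cst// mul1e sumr_const => ->.
under eq_integral do rewrite affine_bary.
rewrite intE affine_centroid ?card_bary_gt0// -EFinM; congr EFin.
by rewrite -mulr_sumr -mulr_natr mulr1; field.
Qed.
End barycentric.

Section topology_rV.
Variables (R : realType) (n : nat).
Local Notation E := 'rV[R]_n.

Lemma continuous_affine (l : E * R) : continuous (affine l).
Proof.
move=> x; rewrite /affine /dot; apply: (@cvgD _ R^o _ (nbhs x) _
  (fun x => \sum_i l.1 0 i * x 0 i) (cst l.2)); last exact: cvg_cst.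
apply: cvg_big => [|i _]; first exact: add_continuous.
apply: cvgM; first exact: cvg_cst.
exact: coord_continuous.
Qed.

Lemma nbhs_line (x w : E) (U : set E) : nbhs x U ->
  exists2 d : R, 0 < d & forall t, 0 <= t <= d -> U (x + t *: w).
Proof.
move=> xU.
have h : (x + t *: w) @[t --> (0 : R)] --> x.
  rewrite -[X in _ --> X]addr0 -[X in _ --> x + X](scale0r w).
  by apply: cvgD; [exact: cvg_cst|apply: cvgZr_tmp; exact: cvg_id].
have /nbhs_ballP[e /= e0 eU] := h _ xU.
exists (e / 2); first by rewrite divr_gt0.
move=> t /andP[t0 te]; apply: eU; rewrite /ball /= sub0r normrN ger0_norm//.
by apply: le_lt_trans te _; rewrite ltr_pdivrMr// ltr_pMr// ltr1n.
Qed.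
End topology_rV.

Lemma negligible_fin_bigcup d (T : measurableType d) (R : realType)
    (mu : {measure set T -> \bar R}) (I : finType) (P : pred I) (F : I -> set T) :
  (forall i, P i -> mu.-negligible (F i)) ->
  mu.-negligible (\bigcup_(i in [set i | P i]) F i).
Proof.
move=> nF; apply: (@negligibleS _ _ _ _ (\big[setU/set0]_(i | P i) F i)).
  rewrite -bigcup_seq_cond => x [i /= Pi Fx]; exists i => //=.
  by rewrite mem_index_enum.
elim/big_ind : _ => //; first exact: negligible_set0.
by move=> *; exact: negligibleU.
Qed.

(** * Simplices described by barycentric coordinates *)

Section simplex.
Variables (R : realType) (n : nat) (V : finType) (p : V -> 'rV[R]_n).
Local Notation E := 'rV[R]_n.
Local Notation mu := (@lebesgue_rV R n).
Implicit Types A : {set V}.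

Lemma vertex_hull A v : v \in A -> convex_hull p A (p v).
Proof.
move=> vA; exists (fun u => (u == v)%:R); split => //.
  by rewrite (bigD1 v)//= eqxx big1 ?addr0// => u /andP[_ /negPf ->].
rewrite (bigD1 v)//= eqxx scale1r big1 ?addr0// => u /andP[_ /negPf ->].
by rewrite scale0r.
Qed.

(** Affine independence makes the matrix with rows [(p v, 1)] invertible, and the columns of its
    inverse are the coordinate functions. [pinvmx] serves as the inverse because the matrix is
    square only through the equation [#|A| = n.+1]. *)
Lemma barycentric_exists A : #|A| = n.+1 -> affinely_independent p A ->
  exists L, barycentric A p L.
Proof.
move=> cA indA.
have [v0 v0A] : exists v, v \in A by apply/card_gt0P; rewrite cA.
pose P : 'M[R]_(#|A|, n) := \matrix_i p (enum_val i).
pose M : 'M[R]_(#|A|, n + 1) := row_mx P (const_mx 1).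
have uP (u : 'rV[R]_#|A|) : u *m P = \sum_i u 0 i *: p (enum_val i).
  by rewrite mulmx_sum_row; apply: eq_bigr => i _; rewrite rowK.
have u1 (u : 'rV[R]_#|A|) : (u *m (const_mx 1 : 'cV_#|A|)) 0 0 = \sum_i u 0 i.
  by rewrite mxE; apply: eq_bigr => i _; rewrite mxE mulr1.
have fM : row_full M.
  rewrite /row_full; have /eqP -> : row_free M; last by rewrite cA addn1.
  apply: inj_row_free => u; rewrite mul_mx_row -[0](@row_mx0 _ 1 n 1) => /eq_row_mx[uP0 u10].
  apply/rowP => i; rewrite mxE.
  have rk (W : lmodType R) (w : V -> W) :
      \sum_(v in A) u 0 (enum_rank_in v0A v) *: w v = \sum_i u 0 i *: w (enum_val i).
    by rewrite big_enum_val; apply: eq_bigr => j _; rewrite enum_valK_in.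
  have := @indA (fun v => u 0 (enum_rank_in v0A v)) _ _ (enum_val i) (enum_valP i).
  rewrite enum_valK_in; apply; last by rewrite rk -uP.
  have := rk R^o (fun=> 1).
  under eq_bigr do rewrite [_ *: _]mulr1; move=> ->.
  by under eq_bigr do rewrite [_ *: _]mulr1; rewrite -u1 u10 mxE.
pose N := pinvmx M.
pose L v : E * R := let i := enum_rank_in v0A v in
  (\row_k N (lshift 1 k) i, N (rshift n 0) i).
have LE v x : affine (L v) x = (row_mx x (1%:M : 'M[R]_1) *m N) 0 (enum_rank_in v0A v).
  rewrite [RHS]mxE big_split_ord /= big_ord1; congr (_ + _).
    by apply: eq_bigr => k _; rewrite row_mxEl mxE mulrC.
  by rewrite row_mxEr mxE eqxx mul1r.
have NM x : row_mx x (1%:M : 'M[R]_1) *m N *m M = row_mx x 1%:M.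
  by rewrite mulmxKpV// submx_full.
have L1 x : \sum_(v in A) affine (L v) x = 1.
  rewrite big_enum_val; under eq_bigr do rewrite LE enum_valK_in.
  by have := NM x; rewrite mul_mx_row => /eq_row_mx[_ h]; rewrite -u1 h mxE eqxx.
have Lx x : \sum_(v in A) affine (L v) x *: p v = x.
  rewrite big_enum_val; under eq_bigr do rewrite LE enum_valK_in.
  by have := NM x; rewrite mul_mx_row => /eq_row_mx[h _]; rewrite -uP h.
(* The coordinates of [p j] and the unit coefficients at [j] represent the same point with the same
   sum, so their difference is an affine dependence and vanishes. *)
exists L; split => // i j iA jA; apply/eqP; rewrite -subr_eq0; apply/eqP.
apply: (@indA (fun i => affine (L i) (p j) - (i == j)%:R)) => //.
  rewrite sumrB L1 (bigD1 j)//= eqxx big1 ?addr0 ?subrr// => k /andP[_ /negPf ->].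
  by [].
under eq_bigr do rewrite scalerBl.
rewrite sumrB Lx (bigD1 j)//= eqxx big1 ?addr0 ?scale1r ?subrr// => k /andP[_ /negPf ->].
by rewrite scale0r.
Qed.

Variables (A : {set V}) (L : V -> E * R) (LP : barycentric A p L).
Let ge0 : set R := `[0, +oo[.
Let gt0 : set R := `]0, +oo[.

Lemma convex_hullE : convex_hull p A = bary_region A L ge0.
Proof.
apply/seteqP; split => x /=.
  move=> [c [c0 c1 ->]] v vA; rewrite (bary_coeff LP)//.
  by rewrite /ge0 /= in_itv /= c0.
have [L1 Lx _] := LP.
(* Outside [A] the coordinate functions carry no sign, whereas [convex_hull] wants nonnegative
   weights at every vertex. *)
move=> h; exists (fun v => if v \in A then affine (L v) x else 0); split.
- by move=> v; case: ifPn => // /h; rewrite /ge0 /= in_itv /= andbT.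
- by rewrite -[RHS](L1 x); apply: eq_bigr => v ->.
- by rewrite -{1}(Lx x); apply: eq_bigr => v ->.
Qed.

(** Where the coordinate of [v] is 0, a step towards [p w - p v] makes it negative, so the point is
    not interior; a second vertex [w] exists, as otherwise that coordinate would be constantly 1.
    Conversely, finitely many strict affine inequalities are an open condition. *)
Lemma interior_convex_hull : (convex_hull p A)° = bary_region A L gt0.
Proof.
rewrite convex_hullE; apply/seteqP; split => x /=.
  move=> xi v vA; rewrite /gt0 /= in_itv /= andbT.
  have := nbhs_singleton xi => /(_ v vA); rewrite /ge0 /= in_itv /= andbT.
  rewrite le_eqVlt => /orP[/eqP v0|//].
  have [L1 _ _] := LP.
  have [w /andP[wA wv]] : exists w, (w \in A) && (w != v).
    apply/existsP; apply: contra_eqT (L1 x) => /existsPn h.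
    rewrite (bigD1 v)//= -v0 add0r big1 1?eq_sym ?oner_neq0// => w.
    by move=> /(conj (h w)) [] /negP.
  have [d d0 /(_ d)] := nbhs_line (p w - p v) xi.
  rewrite lexx ltW// => /(_ isT v vA); rewrite /ge0 /= in_itv /= andbT.
  rewrite affineD -v0 dotZr (bary_grad_diff LP)// eqxx [v == w]eq_sym (negPf wv) /=.
  by rewrite add0r sub0r mulrN1 oppr_ge0 leNgt d0.
move=> xgt.
suff : \forall y \near x, forall v : V, v \in A -> 0 < affine (L v) y.
  apply: filterS => y h v vA; rewrite /ge0 /= in_itv /= andbT; exact/ltW/h.
apply: (@filter_forall _ V (fun v y => v \in A -> 0 < affine (L v) y) (nbhs x) _) => v.
have [vA|vA] := boolP (v \in A); last first.
  by apply: filterE.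
have := xgt v vA; rewrite /gt0 /= in_itv /= andbT => lx.
have := @continuous_affine R n (L v) x _ (lt_nbhsr lx).
move=> h; exact: (@filterS _ (nbhs x) _ _ _ (fun y ly _ => ly) h).
Qed.

(** Moving a little towards the centroid makes every coordinate positive. This is what makes the
    filter in [trace] proper at points of the sides. *)
Lemma closure_interior_convex_hull x : convex_hull p A x ->
  closure (convex_hull p A)° x.
Proof.
rewrite interior_convex_hull convex_hullE => Kx U xU.
have [d d0 dU] := nbhs_line (centroid A p - x) xU.
pose t := Num.min d 1.
have t0 : 0 < t by rewrite lt_min d0 ltr01.
exists (x + t *: (centroid A p - x)); split; last first.
  by apply: dU; rewrite (ltW t0) ge_min lexx.
move=> v vA; rewrite /gt0 /= in_itv /= andbT affineD dotZr -affineB.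
rewrite (bary_centroid LP)//.
have := Kx v vA; rewrite /ge0 /= in_itv /= andbT => l0.
have N0 : 0 < #|A|%:R^-1 :> R by rewrite invr_gt0 ltr0n (card_bary_gt0 LP).
have t1 : t <= 1 by rewrite ge_min lexx orbT.
have : 0 <= (1 - t) * affine (L v) x by rewrite mulr_ge0// subr_ge0.
have : 0 < t * #|A|%:R^-1 by rewrite mulr_gt0.
rewrite mulrBl mulrBr; lra.
Qed.

(** The limit sees only interior values, where [f] is affine, and the filter is proper; so the trace
    is the value of the affine extension, whatever [f] is on the sides. *)
Lemma lim_within_affine (f : E -> R) l x :
  (forall y, (convex_hull p A)° y -> f y = affine l y) ->
  convex_hull p A x ->
  lim (f @ within (convex_hull p A)° (nbhs x)) = affine l x.
Proof.
move=> fl Kx; have xc := closure_interior_convex_hull Kx.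
have PF : ProperFilter (within (convex_hull p A)° (nbhs x)).
  exact: within_nbhs_proper.
apply: cvg_lim => //.
apply: cvg_trans; first apply: (@fmap_within_eq _ _ _ _ f (affine l)).
  by move=> y /[!inE]; exact: fl.
by apply: cvg_within_filter; exact: continuous_affine.
Qed.

Lemma convex_hull_closed : closed (convex_hull p A).
Proof.
rewrite convex_hullE (_ : bary_region _ _ _ =
    \bigcap_(v in [set v | v \in A]) (affine (L v) @^-1` ge0)); last first.
  by apply/seteqP; split => x h v; exact: h.
apply: closed_bigI => v _; apply: preimage_closed.
  by move=> x _; exact: continuous_affine.
exact: interval_closed.
Qed.

Lemma measurable_convex_hull : measurable (convex_hull p A).
Proof. by rewrite convex_hullE; apply: measurable_bary_region;
  exact: measurable_itv. Qed.

Lemma measurable_interior_convex_hull : measurable (convex_hull p A)°.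
Proof. by rewrite interior_convex_hull; apply: measurable_bary_region;
  exact: measurable_itv. Qed.

Let mge0 : measurable ge0. Proof. exact: measurable_itv. Qed.
Let mgt0 : measurable gt0. Proof. exact: measurable_itv. Qed.
Let ge0P : ge0 `<=` [set t | 0 <= t].
Proof. by move=> t; rewrite /ge0 /= in_itv /= andbT. Qed.
Let gt0P : gt0 `<=` [set t | 0 <= t].
Proof. by move=> t; rewrite /gt0 /= in_itv /= andbT => /ltW. Qed.

Lemma lebesgue_interior_convex_hull_fin : (mu (convex_hull p A)° < +oo)%E.
Proof. by rewrite interior_convex_hull; apply: (bary_region_fin LP). Qed.

Lemma lebesgue_interior_convex_hull_gt0 : (0 < mu (convex_hull p A)°)%E.
Proof.
rewrite interior_convex_hull; apply: (bary_region_gt0 LP) => // t.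
by rewrite /gt0 /= in_itv /= andbT.
Qed.

Lemma integral_interior_convex_hull l :
  (\int[mu]_(x in (convex_hull p A)°) (affine l x)%:E =
   (affine l (centroid A p))%:E * mu (convex_hull p A)°)%E.
Proof. by rewrite interior_convex_hull; apply: (integral_affine LP). Qed.

(** A point of the hull that is not interior lies on the zero set of some coordinate, which is a
    hyperplane. *)
Lemma boundary_convex_hull_null : (0 < n)%N ->
  mu.-negligible (convex_hull p A `\` (convex_hull p A)°).
Proof.
move=> n0; set K := convex_hull p A.
have mH v : measurable (K `&` affine (L v) @^-1` [set 0]).
  apply: measurableI; first exact: measurable_convex_hull.
  by rewrite -[X in measurable X]setTI; exact: measurable_affine.
apply: (@negligibleS _ _ _ _ (\bigcup_(v in [set v | v \in A])
    (K `&` affine (L v) @^-1` [set 0]))).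
  rewrite /K interior_convex_hull => x [Kx] /existsNP[v /not_implyP[vA]].
  rewrite /gt0 /= in_itv /= andbT => lv; exists v => //; split => //=.
  move: Kx; rewrite convex_hullE => /(_ v vA); rewrite /ge0 /= in_itv /= andbT.
  by move=> v0; apply/le_anti; rewrite v0 andbT leNgt; apply/negP.
apply: negligible_fin_bigcup => v vA; apply/negligibleP => //.
(* If [v] were the only vertex, [dot (L v).1 (p v)] would be 0 by [bary_grad_sum] and [n] by
   [bary_grad_trace]. *)
have [w wv wA] : exists2 w, w != v & w \in A.
  apply: contrapT => /forall2NP h; have := bary_grad_trace LP.
  rewrite (bigD1 v)//= big1 ?addr0; last first.
    by move=> w /andP[wA wv]; case: (h w).
  have := bary_grad_sum LP (p v); rewrite (bigD1 v)//= big1 ?addr0; last first.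
    by move=> w /andP[wA wv]; case: (h w).
  by move=> -> /esym/eqP; rewrite pnatr_eq0 -leqn0 leqNgt n0.
apply: (@lebesgue_rV_hyperplane _ _ (L v).1 (p v - p w) (L v).2) => //.
  by rewrite (bary_grad_diff LP)// eqxx [v == w]eq_sym (negPf wv) subr0.
apply: (@le_lt_trans _ _ (mu K)).
  by apply: le_measure; rewrite ?inE//; exact: measurable_convex_hull.
by rewrite /K convex_hullE; apply: (bary_region_fin LP).
Qed.
End simplex.

(** * Neighbouring simplices and the divergence theorem on one simplex *)

Section adjacent_simplices.
Variables (R : realType) (n : nat) (V : finType) (p : V -> 'rV[R]_n).
Local Notation E := 'rV[R]_n.
Local Notation mu := (@lebesgue_rV R n).

Lemma norm2Z (k : R) (x : E) : norm2 (k *: x) = `|k| * norm2 x.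
Proof. by rewrite /norm2 dotZl dotZr mulrA -expr2 sqrtrM ?sqr_ge0// sqrtr_sqr. Qed.

Variables (A A' : {set V}) (L L' : V -> E * R).
Hypotheses (LP : barycentric A p L) (LP' : barycentric A' p L').
Variables (v v' : V).
Hypotheses (vA : v \in A) (vA' : v' \in A') (AA' : A :\ v = A' :\ v').
Let k := affine (L v) (p v').

(** Both sides are affine and vanish at the vertices of the common side. Up to sign, the factor [k]
    is the ratio of the heights of the two simplices over that side. *)
Lemma bary_adjacent x : affine (L v) x = k * affine (L' v') x.
Proof.
have [_ _ Lq] := LP.
rewrite (affine_bary LP') (big_setD1 v' vA') /= -AA' big1 ?addr0 1?mulrC// => u.
rewrite !inE => /andP[uv uA].
by rewrite Lq// eq_sym (negPf uv) mulr0.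
Qed.

Lemma bary_adjacent_neq0 : k != 0.
Proof.
have [_ _ Lq] := LP; apply/eqP => k0; have := bary_adjacent (p v).
by rewrite Lq// eqxx k0 mul0r => /eqP; rewrite oner_eq0.
Qed.

(** With [lebesgue_adjacent] this makes volume times [norm2] of the gradient the same on both sides:
    one factor is multiplied by [|k|] and the other divided by it. *)
Lemma bary_grad_adjacent : (L v).1 = k *: (L' v').1.
Proof.
apply/rowP => i; rewrite -!dot_delta dotZl.
have := affineB (L v) (delta_mx 0 i) 0; rewrite subr0 => <-.
have := affineB (L' v') (delta_mx 0 i) 0; rewrite subr0 => <-.
by rewrite !bary_adjacent mulrBr.
Qed.

(* The dilation that fixes the common side and moves [p v] to [p v'] maps the
   first simplex onto the second. *)
Lemma lebesgue_adjacent :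
  mu (convex_hull p A')° = (`|k|%:E * mu (convex_hull p A)°)%E.
Proof.
pose F := dilation (L v).1 (p v' - p v) (L v).2.
have kE : 1 + dot (L v).1 (p v' - p v) = k.
  have [_ _ Lq] := LP; have := Lq v v vA vA.
  by rewrite /k -affineB => ->; rewrite eqxx /=; ring.
have FE x : F x = \sum_(u in A') (if u == v' then affine (L v) x else affine (L u) x) *: p u.
  have [_ Lx _] := LP.
  rewrite (big_setD1 v' vA') /= eqxx /F /dilation -/(affine (L v) x).
  rewrite -[X in X + _](Lx x) (big_setD1 v vA) /= -AA' scalerBr.
  rewrite [RHS](_ : _ = affine (L v) x *: p v' +
    \sum_(i in A :\ v) affine (L i) x *: p i); last first.
    congr (_ + _); apply: eq_bigr => u; rewrite AA' !inE => /andP[uv' _].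
    by rewrite (negPf uv').
  by rewrite [LHS]addrC [LHS]addrA; congr (_ + _); rewrite subrK.
have c1 x : \sum_(u in A') (if u == v' then affine (L v) x else affine (L u) x) = 1.
  have [L1 _ _] := LP.
  rewrite (big_setD1 v' vA') /= eqxx -(L1 x) (big_setD1 v vA) /= -AA'; congr (_ + _).
  by apply: eq_bigr => u; rewrite AA' !inE => /andP[uv' _]; rewrite (negPf uv').
have FA : F @^-1` (convex_hull p A')° = (convex_hull p A)°.
  rewrite (interior_convex_hull LP) (interior_convex_hull LP').
  apply/seteqP; split => x /=.
    move=> h u uA; have [->|uv] := eqVneq u v.
      by have := h v' vA'; rewrite FE (bary_coeff LP')// eqxx.
    have : u \in A :\ v by rewrite !inE uv.
    rewrite AA' !inE => /andP[uv' uA']; have := h u uA'.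
    by rewrite FE (bary_coeff LP')// (negPf uv').
  move=> h u uA'; rewrite FE (bary_coeff LP')//; case: eqVneq => uv'.
    exact: h.
  have : u \in A' :\ v' by rewrite !inE uv'.
  by rewrite -AA' !inE => /andP[_]; exact: h.
have k0 : k != 0 by exact: bary_adjacent_neq0.
have := @lebesgue_rV_dilation R n (L v).1 (p v' - p v) (L v).2 (convex_hull p A')°.
rewrite -/F FA kE => ->//; last exact: (measurable_interior_convex_hull LP').
by rewrite muleA -EFinM mulfV ?mul1e// normr_eq0.
Qed.

End adjacent_simplices.

Section element_identity.
Variables (R : realType) (n : nat) (V : finType) (p : V -> 'rV[R]_n).
Local Notation E := 'rV[R]_n.
Variables (A : {set V}) (L : V -> E * R) (LP : barycentric A p L).
Hypotheses (n0 : (0 < n)%N) (cA : #|A| = n.+1).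

(* Up to the factor [- norm2 (L u).1], [c u] is the constant normal component of
   y on the side opposite to u. These constants determine y, as
   [dot (y x) (L u).1 = c u - (\sum_w c w) * affine (L u) x]. *)
Lemma element_integration_by_parts (l : E * R) (Y : 'I_n -> E * R) (c : V -> R) :
  let y x : E := \row_i affine (Y i) x in
  (forall u w, u \in A -> w \in A -> w != u -> dot (y (p w)) (L u).1 = c u) ->
  dot l.1 (y (centroid A p)) + affine l (centroid A p) * (\sum_i (Y i).1 0 i) =
  - n%:R * \sum_(u in A) c u * affine l (centroid (A :\ u) p).
Proof.
move=> y yc; pose G := \sum_(u in A) c u.
have [L1 Lx Lq] := LP.
have nR : n%:R != 0 :> R by rewrite pnatr_eq0 -lt0n.
have nR1 : n.+1%:R != 0 :> R by rewrite pnatr_eq0.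
have yE0 u x : u \in A -> dot (y x) (L u).1 =
    c u + (dot (y (p u)) (L u).1 - c u) * affine (L u) x.
  move=> uA.
  pose m : E * R := (\sum_i (L u).1 0 i *: (Y i).1, \sum_i (L u).1 0 i * (Y i).2).
  have mE z : dot (y z) (L u).1 = affine m z.
    rewrite /affine /m /= dot_suml -big_split /=.
    by apply: eq_bigr => i _; rewrite mxE dotZl /affine; ring.
  rewrite mE (affine_bary LP) (big_setD1 u)//= -mE.
  rewrite (eq_bigr (fun w => affine (L w) x * c u)); last first.
    by move=> w; rewrite !inE => /andP[wu wA]; rewrite -mE yc.
  have s1 : \sum_(w in A :\ u) affine (L w) x = 1 - affine (L u) x.
    by rewrite -[in RHS](L1 x) (big_setD1 u uA) /= addrAC subrr add0r.
  by rewrite -mulr_suml s1; ring.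
(* Only the value at the opposite vertex was still free; at [p q] the normal components of all other
   sides are known, and the sum over all gradients is zero. *)
have yG q : q \in A -> dot (y (p q)) (L q).1 - c q = - G.
  move=> qA; have := bary_grad_sum LP (y (p q)).
  under eq_bigr => u uA do rewrite dotC yE0 ?(Lq u q)//.
  rewrite big_split /= -/G (big_setD1 q)//= eqxx mulr1 big1 ?addr0.
    by move=> /eqP; rewrite addrC addr_eq0 => /eqP.
  by move=> u; rewrite !inE => /andP[/negPf -> _]; rewrite mulr0.
have yE u x : u \in A -> dot (L u).1 (y x) = c u - G * affine (L u) x.
  by move=> uA; rewrite dotC yE0// yG// mulNr.
(* The Jacobian of [y] is [- G] times the identity, so its trace is [- G * n%:R]. *)
have trE : \sum_i (Y i).1 0 i = - G * n%:R.
  transitivity (\sum_(i < n) - G); last by rewrite sumr_const card_ord mulr_natr.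
  apply: eq_bigr => i _.
  rewrite -dot_delta -[delta_mx 0 i]subr0 -affineB.
  have -> : affine (Y i) (delta_mx 0 i) - affine (Y i) 0 = (y (delta_mx 0 i) - y 0) 0 i.
    by rewrite !mxE.
  rewrite -(bary_grad_decomp LP (y _)) -[y 0](bary_grad_decomp LP) -sumrB.
  rewrite (eq_bigr (fun u => (- G) *: (dot (L u).1 (delta_mx 0 i) *: p u))); last first.
    move=> u uA; rewrite -scalerBl !yE// scalerA; congr (_ *: _).
    by have := affineB (L u) (delta_mx 0 i) 0; rewrite subr0 => <-; ring.
  by rewrite -scaler_sumr (bary_grad_decomp LP) !mxE !eqxx mulr1.
set cA0 := centroid A p.
have lc : affine l cA0 = n.+1%:R^-1 * \sum_(u in A) affine l (p u).
  by rewrite affine_centroid cA.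
have lyE : dot l.1 (y cA0) = \sum_(u in A) c u * affine l (p u) - G * affine l cA0.
  rewrite -(bary_grad_decomp LP (y _)) dot_sumr.
  under eq_bigr => u uA do rewrite dotZr yE// (bary_centroid LP)// cA.
  (* The coefficients [c u - G * n.+1%:R^-1] sum to zero, so the constant [l.2] may be inserted to
     turn [dot l.1 (p u)] into [affine l (p u)]. *)
  rewrite (eq_bigr (fun u => c u * affine l (p u) - G * n.+1%:R^-1 * affine l (p u)
      - (c u - G * n.+1%:R^-1) * l.2)); last by move=> u _; rewrite /affine; ring.
  rewrite sumrB sumrB -mulr_suml sumrB sumr_const cA -/G -mulr_sumr lc -mulrA.
  by rewrite -[G / _ *+ n.+1]mulr_natr mulfVK// subrr mul0r subr0.
have lcu u : u \in A ->
    n%:R * affine l (centroid (A :\ u) p) = n.+1%:R * affine l cA0 - affine l (p u).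
  move=> uA; have cu : #|A :\ u| = n by have := cardsD1 u A; rewrite uA cA => -[].
  rewrite affine_centroid cu// mulVKf// lc mulVKf//.
  by rewrite [in RHS](big_setD1 u)//= addrAC subrr add0r.
rewrite lyE trE mulNr mulr_sumr.
under [in RHS]eq_bigr => u uA do rewrite mulrCA lcu// mulrBr.
rewrite sumrB -mulr_suml -/G -[n.+1%:R]natr1; ring.
Qed.
End element_identity.

(** * Integrals over sides *)

Section reference_simplex.
Variables (R : realType) (m : nat).
Local Notation E := 'rV[R]_m.
Let q (j : 'I_m.+1) : E := if unlift ord0 j is Some i then delta_mx 0 i else 0.
Let L (j : 'I_m.+1) : E * R :=
  if unlift ord0 j is Some i then (delta_mx 0 i, 0) else (- const_mx 1, 1).

Let L0 x : affine (L ord0) x = 1 - \sum_i x 0 i.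
Proof.
rewrite /L unlift_none /affine /= dotNl addrC; congr (_ - _).
by apply: eq_bigr => i _; rewrite mxE mul1r.
Qed.

Let LS x i : affine (L (lift ord0 i)) x = x 0 i.
Proof. by rewrite /L liftK /affine /= addr0 dotC dot_delta. Qed.

Lemma reference_barycentric : barycentric [set: 'I_m.+1]%SET q L.
Proof.
split.
- move=> x; under eq_bigl do rewrite inE; rewrite big_ord_recl L0.
  rewrite [X in _ + X = _](_ : _ = \sum_i x 0 i) ?subrK//.
  by apply: eq_bigr => i _; exact: LS.
- move=> x; under eq_bigl do rewrite inE; rewrite big_ord_recl.
  rewrite {1}/q unlift_none scaler0 add0r [RHS]row_sum_delta.
  by apply: eq_bigr => i _; rewrite /q liftK; congr (_ *: _); exact: LS.
- move=> i j _ _; rewrite /q.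
  case: (unliftP ord0 i) => [i' ->|->]; rewrite ?LS ?L0;
    case: (unliftP ord0 j) => [j' ->|->].
  + by rewrite mxE eqxx /= (inj_eq lift_inj).
  + by rewrite mxE eq_sym (negPf (neq_lift _ _)).
  + rewrite (bigD1 j')//= mxE !eqxx big1 ?addr0 ?subrr ?(negPf (neq_lift _ _))// => k kj.
    by rewrite mxE (negPf kj) andbF.
  + by rewrite big1 ?subr0 ?eqxx// => k _; rewrite mxE.
Qed.

Lemma reference_simplexE :
  @reference_simplex R m = bary_region [set: 'I_m.+1]%SET L `[0, +oo[.
Proof.
apply/seteqP; split => x /=.
  move=> [x0 x1] j _; rewrite /= in_itv /= andbT.
  by case: (unliftP ord0 j) => [i ->|->]; rewrite ?LS ?L0 ?subr_ge0.
move=> h; split => [i|].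
  by have := h (lift ord0 i) (finset.in_setT _); rewrite /= in_itv /= andbT LS.
by have := h ord0 (finset.in_setT _); rewrite /= in_itv /= andbT L0 subr_ge0.
Qed.

Let pos0 : `[0, +oo[%classic `<=` [set t : R | 0 <= t].
Proof. by move=> t; rewrite /= in_itv /= andbT. Qed.

(** The bracket is the value at the centroid. The volume stays anonymous because only its positivity
    enters: a vanishing integral must force a vanishing centroid value. *)
Lemma Rintegral_reference_simplex (a : E) b :
  exists2 vol : R, 0 < vol &
  \int[lebesgue_rV m]_(t in @reference_simplex R m) (dot a t + b) =
  vol * (b + m.+1%:R^-1 * \sum_i a 0 i).
Proof.
set K := @reference_simplex R m.
have Kfin : (lebesgue_rV m K < +oo)%E.
  by rewrite /K reference_simplexE; apply: (bary_region_fin reference_barycentric).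
have K0 : (0 < lebesgue_rV m K)%E.
  rewrite /K reference_simplexE; apply: (bary_region_gt0 reference_barycentric) => // t.
  by rewrite /= in_itv /= andbT => /ltW.
exists (fine (lebesgue_rV m K)); first by rewrite fine_gt0// K0.
rewrite /Rintegral.
have := @integral_affine R m _ _ _ _ reference_barycentric
  `[0, +oo[ (measurable_itv _) pos0 (a, b).
rewrite -reference_simplexE -/K /= => ->.
rewrite fineM//; last by rewrite ge0_fin_numE.
rewrite mulrC; congr (_ * _).
rewrite affine_centroid ?cardsT ?card_ord//.
rewrite /= (eq_bigl xpredT) => [|i]; last by rewrite inE.
rewrite big_ord_recl /q unlift_none.
rewrite [X in _ * (_ + X)](_ : _ = \sum_(i < m) (a 0 i + b)); last first.
  by apply: eq_bigr => i _; rewrite liftK /affine /= dot_delta.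
rewrite /affine /= dot0r add0r.
rewrite big_split /= sumr_const card_ord addrCA -mulrS mulrDr addrC.
by rewrite -[b *+ _]mulr_natl mulKf// pnatr_eq0.
Qed.
End reference_simplex.

Section side_integral.
Variables (R : realType) (m : nat) (Th : mesh R m.+1).
Local Notation E := 'rV[R]_m.+1.
Variables (T : {set vertex Th}) (L : vertex Th -> E * R).
Hypotheses (LP : barycentric T (pos Th) L) (cT : #|T| = m.+2).
Variables (v : vertex Th) (vT : v \in T).
Local Notation S := (T :\ v).

Let cS : #|S| = m.+1.
Proof. by have := cardsD1 v T; rewrite vT cT => -[]. Qed.

Let w i : vertex Th := nth v (enum S) i.

Let wS i : (i < m.+1)%N -> w i \in S.
Proof. by move=> im; rewrite -mem_enum mem_nth// -cardE cS. Qed.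

Let sw i : (i < m.+1)%N -> side_vertex S i = pos Th (w i).
Proof. by move=> im; rewrite /side_vertex (nth_map v)// -cardE cS. Qed.

Let w_inj i j : (i < m.+1)%N -> (j < m.+1)%N -> (w i == w j) = (i == j).
Proof. by move=> im jm; rewrite nth_uniq ?enum_uniq// -cardE cS. Qed.

Lemma sum_side (W : zmodType) (F : vertex Th -> W) :
  \sum_(u in S) F u = F (w 0) + \sum_(i < m) F (w i.+1).
Proof.
rewrite -big_enum /= (big_nth v) -cardE cS big_mkord big_ord_recl.
by congr (_ + _); apply: eq_bigr => i _; rewrite lift0.
Qed.

Let B := side_edges S.

Let BE i : row i B = pos Th (w i.+1) - pos Th (w 0).
Proof. by rewrite /B /side_edges rowK !sw ?ltnS. Qed.

Let mulB (t : 'rV[R]_m) : t *m B = \sum_i t 0 i *: (pos Th (w i.+1) - pos Th (w 0)).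
Proof. by rewrite mulmx_sum_row; apply: eq_bigr => i _; rewrite BE. Qed.

Let ST u : u \in S -> u \in T.
Proof. by rewrite !inE => /andP[]. Qed.

Let wT i : (i < m.+1)%N -> w i \in T.
Proof. by move=> im; rewrite ST// wS. Qed.

Let Bg : B *m ((L v).1)^T = 0.
Proof.
apply/matrixP => i j; rewrite !mxE ord1.
transitivity (dot (L v).1 (row i B)).
  by rewrite dotC; apply: eq_bigr => k _; rewrite !mxE.
have wv k : (k < m.+1)%N -> (v == w k) = false.
  by move=> km; have := wS km; rewrite !inE eq_sym => /andP[/negPf].
by rewrite BE (bary_grad_diff LP) ?wT// ?wv// ?subrr// ltnS.
Qed.

Let gg : 0 < dot (L v).1 (L v).1.
Proof.
have [u us] : exists u, u \in S by exists (w 0); exact: wS.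
have := bary_grad_diff LP vT vT (ST us); rewrite eqxx.
have -> : (v == u) = false by move: us; rewrite !inE eq_sym => /andP[/negPf].
by rewrite subr0 => g1; apply: (dot_gt0 (y := pos Th v - pos Th u)); rewrite g1 oner_neq0.
Qed.

(* Adjoining the normal direction as a first row makes the edge matrix square;
   the Gram determinant is then the square of a nonzero determinant divided by
   the squared length of that row. *)
Lemma gram_side_gt0 : 0 < \det (B *m B^T).
Proof.
pose g := (L v).1; pose C : 'M[R]_(1 + m, m.+1) := col_mx g B.
have CC : C *m C^T = block_mx (dot g g)%:M 0 0 (B *m B^T).
  rewrite /C tr_col_mx mul_col_row Bg; congr block_mx.
    by apply/matrixP => i j; rewrite !ord1 !mxE eqxx; apply: eq_bigr => k _; rewrite !mxE.
  by apply: trmx_inj; rewrite trmx_mul trmxK Bg trmx0.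
have dC : \det (C : 'M[R]_m.+1) ^+ 2 = dot g g * \det (B *m B^T).
  have <- : \det (block_mx (dot g g)%:M 0 0 (B *m B^T) : 'M[R]_(1 + m)) =
      dot g g * \det (B *m B^T).
    by rewrite (@det_ublock R 1 m) det_scalar expr1.
  by rewrite -CC (@det_mulmx R m.+1) det_tr expr2.
rewrite -(pmulr_rgt0 _ gg) -dC lt_neqAle sqr_ge0 andbT eq_sym expf_eq0 /=.
rewrite -unitfE -unitmxE -row_free_unit; apply: inj_row_free => u.
pose u' : 'M[R]_(1, 1 + m) := u; rewrite -[u]/u' => uC.
have u0 : lsubmx u' *m g + rsubmx u' *m B = 0 by rewrite -mul_row_col hsubmxK.
rewrite -(hsubmxK u').
have ul : lsubmx u' 0 0 = 0.
  have := congr1 (fun z => (z *m g^T) 0 0) u0.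
  rewrite mul0mx mulmxDl -!mulmxA Bg mulmx0 addr0 [RHS]mxE mxE big_ord1 => /eqP.
  rewrite mulf_eq0 => /orP[/eqP //|].
  rewrite mxE (_ : \sum_j _ = dot g g) ?gt_eqF//.
  by apply: eq_bigr => k _; rewrite mxE.
have {}ul : lsubmx u' = 0 by apply/matrixP => i j; rewrite !ord1 ul mxE.
move: u0; rewrite ul mul0mx add0r mulB => u0.
suff -> : rsubmx u' = 0 by rewrite row_mx0.
(* The gradient of the coordinate of [w j.+1] is 1 on the [j]-th edge and 0 on the others, so
   pairing with it reads off one coefficient. *)
apply/rowP => j; have := congr1 (dot (L (w j.+1)).1) u0.
rewrite dot0r dot_sumr (bigD1 j)//= dotZr (bary_grad_diff LP);
  [|by apply: wT; rewrite ?ltnS..].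
rewrite eqxx w_inj ?ltnS//= subr0 mulr1 big1 ?addr0 => [->|i ij]; first by rewrite mxE.
rewrite dotZr (bary_grad_diff LP); [|by apply: wT; rewrite ?ltnS..].
by rewrite !w_inj ?ltnS// eqSS eq_sym [(i : nat) == j](negPf ij) subrr mulr0.
Qed.

(** The integral is a positive Gram factor times a positive reference volume times the value at the
    centroid of the side. This turns the integral condition of Crouzeix--Raviart functions into one
    at side midpoints. *)
Lemma side_integral_affine_succ (f : E -> R) l :
  (forall x, hull S x -> f x = affine l x) ->
  side_integral S f = 0 -> affine l (centroid S (pos Th)) = 0.
Proof.
move=> fl; rewrite /side_integral -/B => /eqP; rewrite mulf_eq0 sqrtr_eq0.
rewrite leNgt gram_side_gt0 /=.
pose a : 'rV[R]_m := \row_i dot l.1 (pos Th (w i.+1) - pos Th (w 0)).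
pose b := affine l (pos Th (w 0)).
have lE t : affine l (side_vertex S 0 + t *m B) = dot a t + b.
  rewrite sw// affineD mulB dot_sumr addrC; congr (_ + _).
  by apply: eq_bigr => i _; rewrite dotZr mxE mulrC.
have side_hull t : reference_simplex t -> hull S (side_vertex S 0 + t *m B).
  (* Weights by position in [enum S]: the first vertex gets the remainder. A vertex outside [S] has
     index [m.+1], for which [insub] fails and the weight is 0. *)
  move=> [t0 t1]; pose c u := if index u (enum S) is i.+1 then
    (if insub i is Some j then t 0 j else 0) else 1 - \sum_i t 0 i.
  have c0 : c (w 0) = 1 - \sum_i t 0 i.
    by rewrite /c /w index_uniq ?enum_uniq// -cardE cS.
  have cSi (i : 'I_m) : c (w i.+1) = t 0 i.
    rewrite /c /w index_uniq ?enum_uniq//; last by rewrite -cardE cS ltnS.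
    by rewrite insubT // => im; congr (t 0 _); apply: val_inj.
  exists c; split.
  - move=> u; rewrite /c; case: index => [|i]; first by rewrite subr_ge0.
    by case: insub.
  - rewrite sum_side c0 [X in _ + X = _](_ : _ = \sum_i t 0 i) ?subrK//.
    by apply: eq_bigr => i _; exact: cSi.
  - rewrite sum_side c0.
    rewrite [X in _ = _ + X](_ : _ = \sum_(i < m) t 0 i *: pos Th (w i.+1)); last first.
      by apply: eq_bigr => i _; rewrite cSi.
    rewrite mulB sw// scalerBl scale1r -addrA; congr (_ + _).
    rewrite addrC scaler_suml -sumrB; apply: eq_bigr => i _; rewrite scalerBr.
    by [].
have -> : \int[lebesgue_rV m]_(t in @reference_simplex R m) f (side_vertex S 0 + t *m B) =
    \int[lebesgue_rV m]_(t in @reference_simplex R m) (dot a t + b).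
  by apply: eq_Rintegral => t /[!inE] tr; rewrite fl ?lE//; exact: side_hull.
have [vol vol0 ->] := Rintegral_reference_simplex a b.
rewrite mulf_eq0 gt_eqF//= => /eqP h.
rewrite affine_centroid cS// sum_side.
rewrite -[RHS]h -/b.
rewrite (eq_bigr (fun i : 'I_m => a 0 i + b)); last first.
  by move=> i _; rewrite mxE -affineB subrK.
rewrite big_split /= sumr_const card_ord.
by rewrite addrCA -mulrS mulrDr -[b *+ _]mulr_natl mulKf ?pnatr_eq0// addrC.
Qed.
End side_integral.

Lemma side_integral_affine (R : realType) (d : nat) (Th : mesh R d)
    (T : {set vertex Th}) (L : vertex Th -> 'rV[R]_d * R) (v : vertex Th)
    (f : 'rV[R]_d -> R) l :
  (0 < d)%N -> barycentric T (pos Th) L -> #|T| = d.+1 -> v \in T ->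
  (forall x, hull (T :\ v) x -> f x = affine l x) ->
  side_integral (T :\ v) f = 0 -> affine l (centroid (T :\ v) (pos Th)) = 0.
Proof.
case: d Th T L v f l => // m Th T L v f l _ LP cT vT.
exact: (side_integral_affine_succ LP).
Qed.

(** * Integrals and null sets *)

Section null_sets.
Context d (T : measurableType d) (R : realType).
Variable mu : {measure set T -> \bar R}.
Local Open Scope ereal_scope.
Import HBNNSimple.

Let ge0_integral_off_null (N : set T) (f g : T -> \bar R) :
  measurable N -> mu N = 0 -> (forall x, 0 <= f x) -> (forall x, 0 <= g x) ->
  (forall x, ~ N x -> f x = g x) -> \int[mu]_x f x <= \int[mu]_x g x.
Proof.
move=> mN N0 f0 g0 fg; have mCN := measurableC mN.
rewrite !ge0_integralTE//; apply: ge_ereal_sup => _ [h /= hf <-].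
have -> : sintegral mu h = sintegral mu (proj_nnsfun h mCN).
  have E (k : {nnsfun T >-> R}) : sintegral mu k = \int[mu]_x (k x)%:E.
    by rewrite (integral_nnsfun mu measurableT) patch_setT.
  rewrite !E.
  apply: ae_eq_integral => //; [by apply/measurable_EFinP..|].
  exists N; split => // x /= /not_implyP[_ hx]; apply: contrapT => Nx; apply: hx.
  by rewrite mindicE mem_set// mulr1.
apply: ereal_sup_ubound => /=; exists (proj_nnsfun h mCN) => // x /=.
rewrite mindicE; have [|] := boolP (x \in ~` N); rewrite ?inE ?notin_setE.
  by move=> Nx; rewrite mulr1 -fg.
by move=> _; rewrite mulr0.
Qed.

(* No measurability of f and g is needed: a simple function below f may be set
   to 0 on N without changing its integral. *)
Lemma integral_off_null (N D D' : set T) (f g : T -> \bar R) :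
  measurable N -> mu N = 0 ->
  (forall x, ~ N x -> (f \_ D) x = (g \_ D') x) ->
  \int[mu]_(x in D) f x = \int[mu]_(x in D') g x.
Proof.
move=> mN N0 fg; rewrite [LHS]integral_mkcond [RHS]integral_mkcond.
rewrite [LHS]integralE [RHS]integralE.
congr (_ - _); apply/eqP; rewrite eq_le; apply/andP; split;
  apply: (ge0_integral_off_null mN N0) => //= x Nx; by rewrite ?funeposE ?funenegE fg.
Qed.

Lemma integral_bigsetU_seq (I : choiceType) (F : I -> set T) (f : T -> \bar R) (s : seq I) :
  (forall i, i \in s -> measurable (F i)) ->
  (forall i, i \in s -> measurable_fun (F i) f) -> uniq s ->
  (forall i j, i \in s -> j \in s -> i != j -> F i `&` F j = set0) ->
  \int[mu]_(x in \big[setU/set0]_(i <- s) F i) f x =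
  \sum_(i <- s) \int[mu]_(x in F i) f x.
Proof.
move=> mF mf us dF.
suff : [/\ measurable (\big[setU/set0]_(i <- s) F i),
  measurable_fun (\big[setU/set0]_(i <- s) F i) f &
  \int[mu]_(x in \big[setU/set0]_(i <- s) F i) f x =
  \sum_(i <- s) \int[mu]_(x in F i) f x] by case.
elim: s us mF mf dF => [_ _ _ _|i s ih /= /andP[iNs us] mF mf dF].
  by rewrite !big_nil integral_set0; split => //; exact: measurable_fun_set0.
have sub j : j \in s -> j \in i :: s by rewrite inE => ->; rewrite orbT.
have [|||mU mfU intU] := ih us.
- by move=> j js; exact/mF/sub.
- by move=> j js; exact/mf/sub.
- by move=> j k js ks; apply: dF; exact: sub.
have mFi : measurable (F i) by apply: mF; rewrite mem_head.
have mfi : measurable_fun (F i) f by apply: mf; rewrite mem_head.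
rewrite !big_cons; split.
- exact: measurableU.
- by apply/measurable_funU.
- rewrite integral_setU ?intU//; first by apply/measurable_funU.
  apply/disj_setPS => x [Fix]; rewrite -bigcup_seq => -[j /= js Fjx].
  have : (F i `&` F j) x by [].
  rewrite dF ?mem_head ?sub//; apply: contraNneq iNs => ->.
  by [].
Qed.
End null_sets.

(** * Element-wise affine functions on a mesh *)

Section piecewise_affine.
Variables (R : realType) (d : nat).
Local Notation E := 'rV[R]_d.

(** A multi-index of total degree at most 1 is either zero or a single 1, so each monomial is
    constant or a coordinate. *)
Lemma polynomial_le1_affine (f : E -> R) : polynomial_le 1 f ->
  exists l, forall x, f x = affine l x.
Proof.
move=> [c fE].
have term (a : {ffun 'I_d -> 'I_2}) : (\sum_i a i <= 1)%N ->
    exists l, forall x : E, c a * \prod_i x 0 i ^+ a i = affine l x.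
  move=> a1; have [[i0 ai0]|a0] := pselect (exists i0, (a i0 : nat) != 0%N).
    exists (c a *: delta_mx 0 i0, 0) => x.
    move: a1; rewrite (bigD1 i0)//= => a1.
    have ai1 : a i0 = 1%N :> nat by apply/eqP; rewrite eqn_leq lt0n ai0 -ltnS ltn_ord.
    move: a1; rewrite ai1 -[X in (_ <= X)%N]addn0 leq_add2l leqn0 sum_nat_eq0
      => /forall_inP a0.
    rewrite (bigD1 i0)//= ai1 big1 ?mulr1.
      by rewrite /affine addr0 dotZl dotC dot_delta.
    by move=> i /a0 /eqP ->.
  exists (0, c a) => x; rewrite big1 ?mulr1 /affine ?dot0l ?add0r// => i _.
  have -> : (a i : nat) = 0%N by apply/eqP; apply: contra_notT a0 => ai; exists i.
  by [].
suff [l lE] : exists l, forall x : E,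
    \sum_(a <- index_enum {ffun 'I_d -> 'I_2} | (\sum_i a i <= 1)%N)
      c a * \prod_i x 0 i ^+ a i = affine l x.
  by exists l => x; rewrite fE lE.
elim: (index_enum _) => [|a s [l lE]].
  by exists (0, 0) => x; rewrite big_nil /affine dot0l addr0.
case: (leqP (\sum_i a i)%N 1) => [a1|a1].
  have [m mE] := term a a1; exists (m.1 + l.1, m.2 + l.2) => x.
  by rewrite big_cons a1 mE lE /affine /= dotDl; ring.
by exists l => x; rewrite big_cons leqNgt a1 lE.
Qed.

Lemma derive_affine l (x v : E) : 'D_v (affine l : E -> R) x = dot l.1 v.
Proof.
apply: cvg_lim => //.
apply: (@cvg_trans _ ((fun=> dot l.1 v) @ 0^')); last exact: cvg_cst.
apply: near_eq_cvg; near=> h.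
have h0 : h != 0 by near: h; exact: nbhs_dnbhs_neq.
rewrite /= [h *: v + x]addrC affineD dotZr addrAC subrr add0r -[_ *: _]/(_ * _).
by rewrite mulKf.
Unshelve. all: by end_near. Qed.

Lemma near_grad (f : E -> R) l x : (\forall y \near x, f y = affine l y) ->
  grad f x = l.1.
Proof.
move=> fl; apply/rowP => i; rewrite mxE /partial.
by rewrite (near_eq_derive _ fl) derive_affine dot_delta.
Qed.

Lemma near_divergence (f : E -> E) (Y : 'I_d -> E * R) x :
  (\forall y \near x, f y = \row_i affine (Y i) y) ->
  divergence f x = \sum_i (Y i).1 0 i.
Proof.
move=> fY; apply: eq_bigr => i _; rewrite /partial.
rewrite (@near_eq_derive _ _ _ _ (affine (Y i) : E -> R)) ?derive_affine ?dot_delta//.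
by apply: filterS fY => y ->; rewrite mxE.
Qed.

End piecewise_affine.

(** * The domain and its triangulation *)

Section lipschitz_domain.
Variables (R : realType) (d : nat).
Local Notation E := 'rV[R]_d.

(** A Lipschitz domain lies on one side of its boundary: just below the graph there is an open set
    free of [Omega], which cannot be inside the closure. This places element interiors in [Omega]
    itself and not only in its closure. *)
Lemma interior_closure_lipschitz (Omega : set E) :
  open Omega -> lipschitz_boundary Omega -> (closure Omega)° `<=` Omega.
Proof.
move=> oO lipO x xc; apply: contrapT => nOx.
have xb : boundary Omega x.
  by split; [exact: nbhs_singleton xc|move=> /interior_subset].
have [e [g [K [e1 ge gK gO]]]] := lipO x xb.
have gx : dot x e <= g x.
  by rewrite leNgt; apply/negP => /(nbhs_singleton gO) /nOx.
have ee : dot e e = 1.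
  have := e1; rewrite /norm2 => /(congr1 (fun t => t ^+ 2)).
  by rewrite expr1n sqr_sqrtr// dot_ge0.
have : nbhs x ((closure Omega)° `&` [set y | Omega y <-> g y < dot y e]°).
  by apply: filterI; [exact: nbhs_interior|exact: nbhs_interior gO].
(* Going down along [e] keeps [g] by its invariance and lowers [dot y e], so [z] is strictly outside
   while still in the open set. *)
move=> /(nbhs_line (- e))[t t0 /(_ t)].
rewrite lexx ltW// => /(_ isT); set z := _ + _ => -[zc zg].
have gz : dot z e < g z.
  by rewrite /z scalerN -scaleNr ge dotDl dotZl ee; lra.
have gcont : {for z, continuous g}.
  apply/(@cvgrPdist_lt R R^o E (nbhs z) _ g (g z)) => eps eps0.
  have K1 : 0 < `|K| + 1 by rewrite ltr_wpDl.
  near=> y.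
  have := gK (z, y) (conj Logic.I Logic.I) => /= /le_lt_trans; apply.
  apply: (@le_lt_trans _ _ ((`|K| + 1) * `|z - y|)).
    by rewrite ler_wpM2r// (le_trans (ler_norm K))// lerDl.
  rewrite mulrC -ltr_pdivlMr//.
  near: y; apply: cvgr_dist_lt; [exact: cvg_id|exact: divr_gt0].
have dcont : {for z, continuous (fun y => dot y e)}.
  rewrite (_ : (fun y => dot y e) = affine (e, 0)); first exact: continuous_affine.
  by apply/funext => y; rewrite /affine addr0 dotC.
have hcont : {for z, continuous (fun y => g y - dot y e)}.
  exact: (@cvgB R R^o E (nbhs z) _ g (fun y => dot y e) _ _ gcont dcont).
have h0 : 0 < g z - dot z e by rewrite subr_gt0.
have h1 : nbhs z [set y | 0 < g y - dot y e] := hcont _ (lt_nbhsr h0).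
have h2 : nbhs z [set y | Omega y <-> g y < dot y e] := zg.
have nO : nbhs z [set y | ~ Omega y].
  by apply: filterS2 h1 h2 => y /= gy [Og _] /Og; rewrite ltNge ltW// -subr_gt0.
by have [y []] := (interior_subset zc) _ nO.
Unshelve. all: by end_near. Qed.
End lipschitz_domain.

Section mesh_domain.
Variables (R : realType) (d : nat) (hd : (0 < d)%N) (Omega : set 'rV[R]_d).
Local Notation E := 'rV[R]_d.
Local Notation mu := (@lebesgue_rV R d).
Hypothesis hOmega : polyhedral_lipschitz_domain Omega.
Variables (Th : mesh R d) (hTh : conforming_triangulation Omega Th).
Local Notation V := (vertex Th).
Local Notation hull := (@hull R d Th).
Implicit Types T S : {set V}.

Lemma mesh_barycentric : exists L : {set V} -> V -> E * R,
  forall T, T \in elements Th -> barycentric T (pos Th) (L T).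
Proof.
suff /choice[f fP] : forall T, exists LT : V -> E * R,
    T \in elements Th -> barycentric T (pos Th) LT by exists f.
move=> T; have [TTh|TTh] := boolP (T \in elements Th); last by exists (fun=> 0).
have [h _ _] := hTh; have [cT aT] := h T TTh.
by have [LT LTP] := barycentric_exists cT aT; exists LT.
Qed.

Lemma card_element T : T \in elements Th -> #|T| = d.+1.
Proof. by have [h _ _] := hTh => /h[]. Qed.

Lemma element_interior_sub T : T \in elements Th -> (hull T)° `<=` Omega.
Proof.
move=> TTh; have [[[oO _ _ _] _ lipO] [_ cO _]] := (hOmega, hTh).
apply: subset_trans (interior_closure_lipschitz oO lipO).
by apply: interiorS => x Tx; rewrite cO; exists T.
Qed.

Variables (L : {set V} -> V -> E * R)
  (LP : forall T, T \in elements Th -> barycentric T (pos Th) (L T)).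

(** A convex combination over a face is one over the element with weight 0 elsewhere, and the
    weights are the coordinates. *)
Lemma bary_subset T (B : {set V}) x : T \in elements Th -> B \subset T -> hull B x ->
  (forall u, u \in B -> 0 <= affine (L T u) x) /\
  (forall u, u \in T -> u \notin B -> affine (L T u) x = 0).
Proof.
move=> TTh BT [c [c0 c1 ->]].
have E1 (W : zmodType) (F : V -> W) : \sum_(v in B) F v =
      \sum_(v in T) if v \in B then F v else 0.
  rewrite -big_mkcondr /=; apply: eq_bigl => v.
  by rewrite andb_idl// => /(fintype.subsetP BT).
have E2 : \sum_(v in B) c v *: pos Th v =
      \sum_(v in T) (if v \in B then c v else 0) *: pos Th v.
  by rewrite E1; apply: eq_bigr => v _; case: ifP; rewrite ?scale0r.
have c1' : \sum_(v in T) (if v \in B then c v else 0) = 1 by rewrite -E1.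
split => u uB; first by rewrite E2 (bary_coeff (LP TTh) c1') ?uB ?(fintype.subsetP BT).
by move=> uNB; rewrite E2 (bary_coeff (LP TTh) c1')// (negPf uNB).
Qed.

Lemma element_diff T T' : T \in elements Th -> T' \in elements Th -> T != T' ->
  exists2 u, u \in T & u \notin T'.
Proof.
move=> TTh TTh' TT'; apply: contrapT => /forall2NP h; move/eqP: TT'; apply.
apply/eqP; rewrite eqEcard !card_element// leqnn andbT.
by apply/fintype.subsetP => u uT; have [|/negP] := h u; rewrite ?negbK.
Qed.

(** By conformity a common point lies in the hull of the common vertices; the coordinate of a vertex
    of [T] outside [T'] then vanishes, which is impossible in the interior of [T]. *)
Lemma element_interior_disjoint T T' : T \in elements Th -> T' \in elements Th ->
  T != T' -> (hull T)° `&` (hull T')° = set0.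
Proof.
move=> TTh TTh' TT'; rewrite -subset0 => x [Tx T'x].
have [u uT uT'] := element_diff TTh TTh' TT'.
have [_ _ cf] := hTh.
have : (hull T `&` hull T') x by split; apply: interior_subset.
rewrite cf// => /(bary_subset TTh (finset.subsetIl _ _)) [_ /(_ u uT)].
rewrite inE uT /= => /(_ uT') u0.
move: Tx; rewrite /hull (interior_convex_hull (LP TTh)) => /(_ u uT).
by rewrite /= in_itv /= andbT u0 ltxx.
Qed.

Lemma mesh_null_set : exists N, [/\ measurable N, mu N = 0%E &
  Omega `<=` N `|` \bigcup_(T in [set` elements Th]) (hull T)°].
Proof.
have : mu.-negligible (\bigcup_(T in [set T | T \in elements Th]) (hull T `\` (hull T)°)).
  by apply: negligible_fin_bigcup => T TTh; apply: (boundary_convex_hull_null (LP TTh)).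
move=> [N [mN N0 subN]]; exists N; split => // x Ox.
have : closure Omega x by exact: subset_closure.
have [_ -> _] := hTh; move=> [T TTh Tx].
have [Tix|nTix] := pselect ((hull T)° x); first by right; exists T.
by left; apply: subN; exists T.
Qed.

Lemma measurable_element T : T \in elements Th -> measurable (hull T)°.
Proof. by move=> TTh; apply: measurable_interior_convex_hull (LP TTh). Qed.

Definition volume T := fine (mu (hull T)°).

Lemma volumeE T : T \in elements Th -> mu (hull T)° = (volume T)%:E.
Proof.
move=> TTh; rewrite /volume fineK// ge0_fin_numE//.
exact: (lebesgue_interior_convex_hull_fin (LP TTh)).
Qed.

Lemma volume_gt0 T : T \in elements Th -> 0 < volume T.
Proof.
move=> TTh; rewrite -lte_fin -volumeE//.
exact: (lebesgue_interior_convex_hull_gt0 (LP TTh)).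
Qed.

(** Measurability is asked of the element-wise representatives [g T] only; [f] itself is arbitrary
    on the sides. *)
Lemma integral_mesh (f : E -> \bar R) (g : {set V} -> E -> \bar R) :
  (forall T, T \in elements Th -> measurable_fun setT (g T)) ->
  (forall T x, T \in elements Th -> (hull T)° x -> f x = g T x) ->
  (\int[mu]_(x in Omega) f x =
   \sum_(T in elements Th) \int[mu]_(x in (hull T)°) g T x)%E.
Proof.
move=> mg fg; have [N [mN N0 ON]] := mesh_null_set.
pose s := enum (elements Th).
have sE T : (T \in s) = (T \in elements Th) by rewrite mem_enum.
transitivity (\int[mu]_(x in \big[setU/set0]_(T <- s) (hull T)°) f x)%E.
  apply: (integral_off_null mN N0) => x Nx; rewrite /patch.
  congr (if _ then _ else _); apply/idP/idP; rewrite !inE -bigcup_seq.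
    move=> /ON [//|[T TTh Tx]]; exists T => //=.
    by rewrite sE.
  by move=> [T /=]; rewrite sE => TTh; exact: element_interior_sub.
rewrite integral_bigsetU_seq ?enum_uniq//.
- rewrite big_enum /=; apply: eq_bigr => T TTh.
  by apply: eq_integral => x /[!inE] /fg ->.
- by move=> T; rewrite sE; exact: measurable_element.
- move=> T; rewrite sE => TTh; apply: (@eq_measurable_fun _ _ _ _ _ (g T)).
    by move=> x /[!inE] Tx; rewrite (fg T).
  by apply: measurable_funTS; exact: mg.
- by move=> T T'; rewrite !sE; exact: element_interior_disjoint.
Qed.

(** The constants are extended reals, as the [phi] and [psi] terms and their conjugates may be
    infinite on an element. *)
Lemma integral_mesh_constant (f : E -> \bar R) (c : {set V} -> \bar R) :
  (forall T x, T \in elements Th -> (hull T)° x -> f x = c T) ->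
  (\int[mu]_(x in Omega) f x = \sum_(T in elements Th) c T * (volume T)%:E)%E.
Proof.
move=> fc; rewrite (@integral_mesh f (fun T => cst (c T)))//.
apply: eq_bigr => T TTh; rewrite integral_cst; last exact: measurable_element.
by congr (_ * _)%E; exact: volumeE.
Qed.

Lemma integral_mesh_affine (f : E -> R) (l : {set V} -> E * R) :
  (forall T x, T \in elements Th -> (hull T)° x -> f x = affine (l T) x) ->
  (\int[mu]_(x in Omega) (f x)%:E =
   (\sum_(T in elements Th) affine (l T) (centroid T (pos Th)) * volume T)%:E)%E.
Proof.
move=> fl; rewrite (@integral_mesh _ (fun T x => (affine (l T) x)%:E)).
- rewrite -sumEFin; apply: eq_bigr => T TTh.
  by rewrite (integral_interior_convex_hull (LP TTh)) EFinM -volumeE.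
- by move=> T _; apply/measurable_EFinP; exact: measurable_affine.
- by move=> T x TTh Tx; rewrite (fl T).
Qed.

End mesh_domain.

(** This avoids proving that exactly two elements share an interior side: for a third index [k],
    twice [a k] is a combination of three pair sums, hence zero. *)
Lemma sum_pairwise_cancel (R : numDomainType) (I : finType) (P : pred I) (a : I -> R) :
  (forall i j, P i -> P j -> i != j -> a i + a j = 0) ->
  (forall i, P i -> exists2 j, P j & j != i) -> \sum_(i | P i) a i = 0.
Proof.
move=> aa Pex; case: (pickP P) => [i Pi|P0]; last by rewrite big_pred0.
have [j Pj ji] := Pex i Pi; have aij := aa i j Pi Pj; rewrite eq_sym in aij.
rewrite (bigD1 i)//= (bigD1 j) /=; last by rewrite Pj.
rewrite addrA aij// add0r big1// => k /andP[/andP[Pk ki] kj].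
have aki := aa k i Pk Pi ki; have akj := aa k j Pk Pj kj.
have : a k *+ 2 = 0.
  have -> : a k *+ 2 = (a k + a i) + (a k + a j) - (a i + a j) by ring.
  by rewrite aki akj aij// !addr0 subr0.
by move/eqP; rewrite mulrn_eq0 /= => /eqP.
Qed.

(** * Sides: adjacency, traces and outward normals *)

Section mesh_sides.
Variables (R : realType) (d : nat) (hd : (0 < d)%N) (Omega : set 'rV[R]_d).
Local Notation E := 'rV[R]_d.
Local Notation mu := (@lebesgue_rV R d).
Hypothesis hOmega : polyhedral_lipschitz_domain Omega.
Variables (Th : mesh R d) (hTh : conforming_triangulation Omega Th).
Local Notation V := (vertex Th).
Local Notation hull := (@hull R d Th).
Implicit Types T S : {set V}.
Variables (L : {set V} -> V -> E * R)
  (LP : forall T, T \in elements Th -> barycentric T (pos Th) (L T)).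

Lemma element_hullP T x : T \in elements Th ->
  hull T x <-> forall u, u \in T -> 0 <= affine (L T u) x.
Proof.
move=> TTh; rewrite /hull (convex_hullE (LP TTh)); split => h u uT; have := h u uT;
  by rewrite /= in_itv /= andbT.
Qed.

Lemma card_side T v : T \in elements Th -> v \in T -> #|T :\ v| = d.
Proof.
by move=> TTh vT; have := cardsD1 v T; rewrite vT (card_element hTh TTh) => -[].
Qed.

Lemma bary_side_centroid T v u : T \in elements Th -> v \in T -> u \in T ->
  affine (L T u) (centroid (T :\ v) (pos Th)) = (u != v)%:R / d%:R.
Proof.
move=> TTh vT uT; have [_ _ Lq] := LP TTh.
rewrite affine_centroid card_side// mulrC; congr (_ / _).
have [->|uv] := eqVneq u v.
  by rewrite big1// => w; rewrite !inE => /andP[wv wT]; rewrite Lq// eq_sym (negPf wv).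
rewrite (bigD1 u) ?inE ?uv//= Lq// eqxx big1 ?addr0// => w.
by rewrite !inE => /andP[/andP[_ wT] wu]; rewrite Lq// eq_sym (negPf wu).
Qed.

Lemma side_sub_hull T v : T \in elements Th -> v \in T -> hull (T :\ v) `<=` hull T.
Proof.
move=> TTh vT x xS; apply/element_hullP => // u uT.
have [h0 h1] := bary_subset LP TTh (subD1set T v) xS.
have [uS|uS] := boolP (u \in T :\ v); first exact: h0.
by rewrite h1.
Qed.

(* Points just beyond a relatively interior point of an interior side lie in
   another element; conformity forces that element to contain the side. *)
Lemma adjacent_element T v : T \in elements Th -> v \in T ->
  ~ (hull (T :\ v) `<=` boundary Omega) ->
  exists T' v', [/\ T' \in elements Th, v' \in T', T' != T & T' :\ v' = T :\ v].
Proof.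
move=> TTh vT /existsNP[x /not_implyP[xS xb]].
have [[[oO _ _ _] _ _] [_ cO cf]] := (hOmega, hTh).
have Ox : Omega x.
  apply: contrapT => nOx; apply: xb; split; last by move=> /interior_subset.
  by rewrite cO; exists T => //; exact: side_sub_hull xS.
have [x0 x1] := bary_subset LP TTh (subD1set T v) xS.
pose c := centroid (T :\ v) (pos Th).
(* The given point may lie on the rim of the side. A step towards the centroid [c], short enough to
   stay in [Omega], yields [z] with all side coordinates positive; [t <= 1] keeps it a convex
   combination. *)
have dR : 0 < d%:R :> R by rewrite ltr0n.
have [e e0 /(_ (Num.min e 1))] := nbhs_line (c - x) (open_nbhs_nbhs (conj oO Ox)).
set t := Num.min e 1; have t0 : 0 < t by rewrite lt_min e0 ltr01.
have t1 : t <= 1 by rewrite ge_min lexx orbT.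
rewrite (ltW t0) ge_min lexx => /(_ isT); set z := x + _ => Oz.
have zE u : affine (L T u) z = (1 - t) * affine (L T u) x + t * affine (L T u) c.
  by rewrite /z affineD dotZr -affineB; ring.
have zpos u : u \in T :\ v -> 0 < affine (L T u) z.
  move=> uS; have := uS; rewrite !inE => /andP[uv uT].
  rewrite zE /c bary_side_centroid// uv mul1r ltr_wpDl//.
    by rewrite mulr_ge0 ?subr_ge0// x0.
  by rewrite mulr_gt0 ?invr_gt0.
have zv : affine (L T v) z = 0.
  by rewrite zE /c bary_side_centroid// eqxx mul0r mulr0 x1 ?mulr0 ?addr0// !inE eqxx.
have zT : hull T z.
  apply/element_hullP => // u uT; have [->|uv] := eqVneq u v; first by rewrite zv.
  by rewrite ltW// zpos// !inE uv.
(* Otherwise [z] has a neighbourhood in [Omega] missing the other, closed, elements. Its point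
   [z + r *: (z - pos Th v)] has coordinate [- r] at [v], so it is not in [T] either, although the
   elements cover [Omega]. *)
have [T' [TTh' TT' zT']] : exists T', [/\ T' \in elements Th, T' != T & hull T' z].
  apply: contrapT => noT'.
  have : nbhs z (Omega `&`
      [set y | forall T' : {set V}, (T' \in elements Th) && (T' != T) -> ~ hull T' y]).
    apply: filterI; first exact: open_nbhs_nbhs (conj oO Oz).
    apply: (@filter_forall _ _ (fun (T' : {set V}) y =>
      (T' \in elements Th) && (T' != T) -> ~ hull T' y) (nbhs z) _) => T'.
    have [/andP[TTh' TT']|_] := boolP ((T' \in elements Th) && (T' != T)); last first.
      exact: filterE.
    have : nbhs z (~` hull T').
      apply: open_nbhs_nbhs; split.
        by apply: closed_openC; exact: (convex_hull_closed (LP TTh')).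
      by move=> zT'; apply: noT'; exists T'.
    by apply: filterS.
  move=> /(nbhs_line (z - pos Th v))[r r0 /(_ r)].
  rewrite lexx (ltW r0) => /(_ isT)[Oy yT'].
  have : closure Omega (z + r *: (z - pos Th v)) by exact: subset_closure.
  rewrite cO => -[T' TTh' yT]; have [T'T|T'T] := eqVneq T' T; last first.
    by apply: (yT' T') => //; apply/andP.
  move: yT; rewrite T'T => /(element_hullP _ TTh)/(_ v vT).
  have [_ _ Lq] := LP TTh.
  rewrite affineD dotZr -affineB zv Lq// eqxx add0r sub0r mulrN1 oppr_ge0.
  by rewrite leNgt r0.
have zI : hull (T :&: T') z by rewrite -cf.
have [_ zI0] := bary_subset LP TTh (finset.subsetIl T T') zI.
have ST' : T :\ v \subset T'.
  apply/fintype.subsetP => u uS; apply: contraT => uT'.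
  have := zpos u uS; rewrite zI0 ?ltxx//; first by move: uS; rewrite !inE => /andP[].
  by rewrite inE (negPf uT') andbF.
have vT' : v \notin T'.
  apply/negP => vT'; move/eqP: TT'; apply; apply/eqP.
  rewrite eq_sym eqEcard !(card_element hTh)// leqnn andbT.
  apply/fintype.subsetP => u uT; have [->//|uv] := eqVneq u v.
  by apply: (fintype.subsetP ST'); rewrite !inE uv.
have [v' v'T' v'T] := element_diff hTh TTh' TTh TT'.
exists T', v'; split => //.
apply/eqP; rewrite eq_sym eqEcard !card_side// leqnn andbT.
apply/fintype.subsetP => u uS; rewrite !inE (fintype.subsetP ST')// andbT.
by apply: contraNneq v'T => <-; move: uS; rewrite !inE => /andP[].
Qed.

Lemma trace_affine T (f : E -> R) l x : T \in elements Th ->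
  (forall y, (hull T)° y -> f y = affine l y) -> hull T x -> trace T f x = affine l x.
Proof. by move=> TTh fl xT; exact: (lim_within_affine (LP TTh)). Qed.

(** [xget] may return any admissible vector, so uniqueness is needed too: orthogonality to the side
    makes it a multiple [c] of the gradient, pointing away from the opposite vertex gives [c <= 0],
    and unit length fixes [c]. *)
Lemma outward_normalE T v : T \in elements Th -> v \in T ->
  0 < norm2 (L T v).1 /\
  outward_normal T (T :\ v) = - (norm2 (L T v).1)^-1 *: (L T v).1.
Proof.
move=> TTh vT; have LT := LP TTh; have [_ _ Lq] := LT.
set g := (L T v).1.
have [s sS] : exists s, s \in T :\ v by apply/card_gt0P; rewrite card_side.
have [sv sT] : s != v /\ s \in T by move: sS; rewrite !inE => /andP[].
have gvs : dot g (pos Th v - pos Th s) = 1.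
  by rewrite (bary_grad_diff LT)// eqxx eq_sym (negPf sv) subr0.
have gg : 0 < dot g g by apply: (dot_gt0 (y := pos Th v - pos Th s)); rewrite gvs oner_neq0.
have ng : 0 < norm2 g by rewrite sqrtr_gt0.
split => //.
have side0 x : hull (T :\ v) x -> affine (L T v) x = 0.
  by move=> /(bary_subset LP TTh (subD1set T v))[_]; apply => //; rewrite !inE eqxx.
have ex : is_outward_normal T (T :\ v) (- (norm2 g)^-1 *: g).
  split.
  - by rewrite norm2Z normrN ger0_norm ?invr_ge0 ?ltW// mulVf// gt_eqF.
  - by move=> x y xS yS; rewrite dotZl -affineB !side0// subrr mulr0.
  - move=> x y xS yT; rewrite dotZl -affineB (side0 x)// subr0 mulNr oppr_le0.
    by rewrite mulr_ge0 ?invr_ge0 ?(ltW ng)//; apply: (element_hullP _ TTh).1.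
rewrite /outward_normal; case: xgetP => [n _ [n1 n0 nle]|/(_ _ ex)//].
pose c := dot n (pos Th v - pos Th s).
have vS w : w \in T :\ v -> hull (T :\ v) (pos Th w) by exact: vertex_hull.
have nw w : dot n w = c * dot g w.
  rewrite -{1}(bary_grad_decomp LT w).
  have -> : \sum_(u in T) dot (L T u).1 w *: pos Th u =
            \sum_(u in T) dot (L T u).1 w *: (pos Th u - pos Th s).
    under [RHS]eq_bigr do rewrite scalerBr.
    by rewrite sumrB -scaler_suml (bary_grad_sum LT) scale0r subr0.
  rewrite dot_sumr (big_setD1 v)//= dotZr -/c big1 ?addr0 1?mulrC// => u uS.
  by rewrite dotZr n0 ?mulr0//; exact: vS.
have nE : n = c *: g by apply/rowP => i; rewrite -!dot_delta nw dotZl.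
have c0 : c <= 0 by apply: nle; [exact: vS|exact: vertex_hull].
have : `|c| * norm2 g = 1 by rewrite -norm2Z -nE.
rewrite ler0_norm// => cg; rewrite nE; congr (_ *: _).
by apply/eqP; rewrite -eqr_oppLR; apply/eqP/(mulIf (lt0r_neq0 ng)); rewrite cg mulVf// gt_eqF.
Qed.

End mesh_sides.

(** * Crouzeix--Raviart and Raviart--Thomas functions in element-wise affine form *)

Section discrete_spaces.
Variables (R : realType) (d : nat) (hd : (0 < d)%N) (Omega : set 'rV[R]_d).
Local Notation E := 'rV[R]_d.
Local Notation mu := (@lebesgue_rV R d).
Hypothesis hOmega : polyhedral_lipschitz_domain Omega.
Variables (Th : mesh R d) (hTh : conforming_triangulation Omega Th).
Local Notation V := (vertex Th).
Local Notation hull := (@hull R d Th).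
Implicit Types T S : {set V}.
Variables (L : {set V} -> V -> E * R)
  (LP : forall T, T \in elements Th -> barycentric T (pos Th) (L T)).

Definition pw_affine (v : E -> R) (l : {set V} -> E * R) :=
  forall T x, T \in elements Th -> (hull T)° x -> v x = affine (l T) x.

Definition affine_field (Y : 'I_d -> E * R) (x : E) : E := \row_i affine (Y i) x.

Definition pw_affine_field (y : E -> E) (Y : {set V} -> 'I_d -> E * R) :=
  forall T x, T \in elements Th -> (hull T)° x -> y x = affine_field (Y T) x.

Lemma pw_polynomial1_affine (v : E -> R) : pw_polynomial Th 1 v ->
  exists l, pw_affine v l.
Proof.
move=> vP.
suff /choice[l lP] : forall T, exists l : E * R, T \in elements Th ->
    forall x, (hull T)° x -> v x = affine l x.
  by exists l => T x TTh; exact: lP.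
move=> T; have [TTh|TTh] := boolP (T \in elements Th); last by exists (0, 0).
have [p /polynomial_le1_affine[l pl] vp] := vP T TTh.
by exists l => _ x Tx; rewrite vp// pl.
Qed.

Lemma pw_polynomial1_affine_field (y : E -> E) :
  (forall i, pw_polynomial Th 1 (fun x => y x 0 i)) ->
  exists Y, pw_affine_field y Y.
Proof.
move=> yP.
have /choice[Y YP] : forall i, exists l, pw_affine (fun x => y x 0 i) l.
  by move=> i; exact: pw_polynomial1_affine.
exists (fun T i => Y i T) => T x TTh Tx; apply/rowP => i.
by rewrite mxE -(YP i T x).
Qed.

Lemma element_interior_near (P : E -> Prop) T x : (hull T)° x ->
  (forall y, (hull T)° y -> P y) -> \forall y \near x, P y.
Proof. by move=> Tx h; apply: filterS h _; exact: nbhs_interior. Qed.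

Lemma grad_pw_affine v l T x : pw_affine v l -> T \in elements Th ->
  (hull T)° x -> grad v x = (l T).1.
Proof.
move=> vl TTh Tx; apply: near_grad; apply: (element_interior_near Tx) => y.
exact: vl.
Qed.

Lemma divergence_pw_affine y Y T x : pw_affine_field y Y -> T \in elements Th ->
  (hull T)° x -> divergence y x = \sum_i (Y T i).1 0 i.
Proof.
move=> yY TTh Tx; apply: near_divergence; apply: (element_interior_near Tx) => z.
exact: yY.
Qed.

Section crouzeix_raviart_sides.
Variables (GammaD : set E) (v : E -> R) (l : {set V} -> E * R).
Hypotheses (hv : crouzeix_raviart Omega Th GammaD v) (vl : pw_affine v l).

(** The jump of the traces is affine on the side, so its zero integral is a zero at the midpoint. *)
Lemma crouzeix_raviart_interior T T' u u' :
  T \in elements Th -> T' \in elements Th -> T != T' -> u \in T -> u' \in T' ->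
  T :\ u = T' :\ u' -> ~ (hull (T :\ u) `<=` boundary Omega) ->
  affine (l T) (centroid (T :\ u) (pos Th)) = affine (l T') (centroid (T :\ u) (pos Th)).
Proof.
move=> TTh TTh' TT' uT uT' e nb; have [_ jump _] := hv.
have sh : shared_interior_side Omega T T' (T :\ u).
  by split => //; split => //; [exists u|exists u'].
have := @side_integral_affine R d Th T (L T) u _ ((l T).1 - (l T').1, (l T).2 - (l T').2)
  hd (LP TTh) (card_element hTh TTh) uT _ (jump _ _ _ sh).
have lE x : affine ((l T).1 - (l T').1, (l T).2 - (l T').2) x =
    affine (l T) x - affine (l T') x.
  by rewrite /affine /= dotBl; ring.
rewrite lE => h; apply/eqP; rewrite -subr_eq0; apply/eqP; apply: h => x xS.
rewrite lE; congr (_ - _); apply: (trace_affine LP) => //.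
- by move=> y; exact: vl.
- exact: (side_sub_hull LP TTh uT).
- by move=> y; exact: vl.
- by apply: (side_sub_hull LP TTh' uT'); rewrite -e.
Qed.

Lemma side_centroid T u : T \in elements Th -> u \in T ->
  hull (T :\ u) (centroid (T :\ u) (pos Th)).
Proof.
move=> TTh uT; have c := card_side hTh TTh uT.
exists (fun=> d%:R^-1); split.
- by move=> _; rewrite invr_ge0.
- by rewrite sumr_const c -[_ *+ _]mulr_natr mulVf// pnatr_eq0 -lt0n.
- by rewrite /centroid c scaler_sumr.
Qed.

Lemma crouzeix_raviart_boundary T u : T \in elements Th -> u \in T ->
  hull (T :\ u) `<=` GammaD -> affine (l T) (centroid (T :\ u) (pos Th)) = 0.
Proof.
move=> TTh uT SD; have [_ _ /(_ T (T :\ u))] := hv.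
have sT : side T (T :\ u) by split => //; exists u.
move=> /(_ sT SD); rewrite (trace_affine LP TTh (l := l T))//.
- by move=> y; exact: vl.
- by apply: (side_sub_hull LP TTh uT); exact: side_centroid.
Qed.
End crouzeix_raviart_sides.

Section raviart_thomas_sides.
Variables (GammaN : set E) (y : E -> E) (Y : {set V} -> 'I_d -> E * R).
Hypotheses (hy : raviart_thomas Omega Th GammaN y) (yY : pw_affine_field y Y).

Lemma normal_trace_affine T S x : T \in elements Th -> hull T x ->
  normal_trace T S y x = dot (affine_field (Y T) x) (outward_normal T S).
Proof.
move=> TTh Tx; set n := outward_normal T S.
pose m : E * R := (\sum_i n 0 i *: (Y T i).1, \sum_i n 0 i * (Y T i).2).
have mE z : dot (affine_field (Y T) z) n = affine m z.
  rewrite /affine /m /= dot_suml -big_split /=.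
  by apply: eq_bigr => i _; rewrite mxE dotZl /affine; ring.
rewrite mE; apply: (trace_affine LP) => // z Tz.
by rewrite (yY TTh Tz) mE.
Qed.

(** [kappa T u] is the outward normal component on the side opposite to [u]; as it is constant
    there, a single point of [GammaN] on a boundary side suffices to make it vanish. *)
Lemma raviart_thomas_flux : exists kappa : {set V} -> V -> R,
  [/\ forall T u x, T \in elements Th -> u \in T -> hull (T :\ u) x ->
        dot (affine_field (Y T) x) (L T u).1 = - norm2 (L T u).1 * kappa T u,
      forall T T' u u', T \in elements Th -> T' \in elements Th -> T != T' ->
        u \in T -> u' \in T' -> T :\ u = T' :\ u' ->
        ~ (hull (T :\ u) `<=` boundary Omega) -> kappa T u + kappa T' u' = 0 &
      forall T u, T \in elements Th -> u \in T ->
        hull (T :\ u) `<=` boundary Omega -> hull (T :\ u) `&` GammaN !=set0 ->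
        kappa T u = 0].
Proof.
have [_ cst jump bd] := hy.
pose kappa T u := normal_trace T (T :\ u) y (centroid (T :\ u) (pos Th)).
have sT T u : T \in elements Th -> u \in T -> side T (T :\ u) by split => //; exists u.
have kE T u x : T \in elements Th -> u \in T -> hull (T :\ u) x ->
    normal_trace T (T :\ u) y x = kappa T u.
  move=> TTh uT xS; have [c cE] := cst _ _ (sT T u TTh uT).
  by rewrite /kappa !cE//; exact: side_centroid.
exists kappa; split.
- move=> T u x TTh uT xS; rewrite -(kE T u x)//.
  rewrite normal_trace_affine//; last exact: (side_sub_hull LP TTh uT).
  have [g0 ->] := outward_normalE hd hTh LP TTh uT.
  by rewrite dotZr mulrA mulrNN mulfV ?mul1r// gt_eqF.
- move=> T T' u u' TTh TTh' TT' uT uT' e nb.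
  have xS := side_centroid TTh uT.
  rewrite -(kE T u _ TTh uT xS) -(kE T' u' (centroid (T :\ u) (pos Th)))// -?e//.
  apply: jump => //; split => //; first exact: sT.
  by rewrite e; exact: sT.
- move=> T u TTh uT Sb [x [xS xN]].
  by rewrite -(kE T u x)//; apply: bd => //; split => //; exact: sT.
Qed.
End raviart_thomas_sides.

Lemma discrete_integration_by_parts GammaD GammaN v l y Y :
  boundary_partition Omega Th GammaD GammaN ->
  crouzeix_raviart Omega Th GammaD v -> pw_affine v l ->
  raviart_thomas Omega Th GammaN y -> pw_affine_field y Y ->
  \sum_(T in elements Th) (dot (l T).1 (affine_field (Y T) (centroid T (pos Th))) +
     affine (l T) (centroid T (pos Th)) * \sum_i (Y T i).1 0 i) * volume T = 0.
Proof.
move=> hGamma hv vl hy yY.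
have [kappa [k1 k2 k3]] := raviart_thomas_flux hy yY.
pose a (q : {set V} * V) := volume q.1 * (- norm2 (L q.1 q.2).1 * kappa q.1 q.2 *
  affine (l q.1) (centroid (q.1 :\ q.2) (pos Th))).
pose P (q : {set V} * V) := (q.1 \in elements Th) && (q.2 \in q.1).
transitivity (- d%:R * \sum_(q | P q) a q).
  rewrite -(pair_big_dep (fun T => T \in elements Th) (fun T u => u \in T)
    (fun T u => a (T, u))) /=.
  rewrite mulr_sumr; apply: eq_bigr => T TTh.
  have := @element_integration_by_parts R d V (pos Th) T (L T) (LP TTh) hd
    (card_element hTh TTh) (l T) (Y T) (fun u => - norm2 (L T u).1 * kappa T u).
  rewrite /= => ->; last first.
    move=> u w uT wT wu; apply: k1 => //.
    by apply: vertex_hull; rewrite !inE wu.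
  rewrite -mulrA mulr_suml; congr (_ * _); apply: eq_bigr => u _.
  by rewrite /a /= mulrC.
(* The sum over pairs of an element and an opposite vertex is regrouped by the side they
   determine. *)
rewrite (partition_big (fun q : {set V} * V => q.1 :\ q.2) xpredT)//= big1 ?mulr0// => S _.
have [_ GDN _ bdS] := hGamma; have [bd _ _ _] := hGamma.
have [Sb|nSb] := pselect (hull S `<=` boundary Omega).
  apply: big1 => -[T u] /andP[/andP[/= TTh uT] /eqP TS].
  suff : kappa T u = 0 \/ affine (l T) (centroid (T :\ u) (pos Th)) = 0.
    by rewrite /a /=; case=> ->; rewrite ?mulr0 ?mul0r ?mulr0.
  (* A boundary side either meets [GammaN], and its flux is zero, or lies in [GammaD], and the
     midpoint value is zero. *)
  have [SN|SN] := pselect (hull (T :\ u) `&` GammaN !=set0).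
    by left; apply: k3 => //; rewrite TS.
  right; apply: (crouzeix_raviart_boundary hv vl) => // x xS.
  have : boundary Omega x by apply: Sb; rewrite -TS.
  by rewrite bd => -[//|xN]; case: SN; exists x.
apply: sum_pairwise_cancel.
- move=> [T u] [T' u'] /andP[/andP[/= TTh uT] /eqP TS] /andP[/andP[/= TTh' uT'] /eqP TS'] ne.
  (* Within one element the side determines the opposite vertex, so distinct pairs over the same
     side have distinct elements. *)
  have TT' : T != T'.
    apply: contraNneq ne => e; subst T'; apply/eqP; congr pair.
    apply: contraTeq uT => uu'; have : u \notin T :\ u by rewrite !inE eqxx.
    by rewrite TS -TS' !inE uu'.
  have e : T :\ u = T' :\ u' by rewrite TS TS'.
  have nb : ~ (hull (T :\ u) `<=` boundary Omega) by rewrite TS.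
  have vv' := crouzeix_raviart_interior hv vl TTh TTh' TT' uT uT' e nb.
  rewrite /a /= -e -vv'.
  have vol' : volume T' = `|affine (L T u) (pos Th u')| * volume T.
    have := lebesgue_adjacent (LP TTh) (LP TTh') uT uT' e.
    by rewrite (volumeE LP TTh) (volumeE LP TTh') -EFinM => -[].
  have gE := bary_grad_adjacent (LP TTh) (LP TTh') uT uT' e.
  have kk := k2 T T' u u' TTh TTh' TT' uT uT' e nb.
  rewrite vol' gE norm2Z; set A := affine (l T) _; set m := `| _ |.
  have -> : kappa T' u' = - kappa T u by apply/eqP; rewrite -addr_eq0 addrC kk.
  ring.
- move=> [T u] /andP[/andP[/= TTh uT] /eqP TS].
  have nb : ~ (hull (T :\ u) `<=` boundary Omega) by rewrite TS.
  have [T' [u' [TTh' uT' TT' e]]] := adjacent_element hd hOmega hTh LP TTh uT nb.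
  exists (T', u'); first by rewrite /P /= TTh' uT' e TS eqxx.
  by apply: contraNneq TT' => -[-> _].
Qed.

Lemma pw_constant_choice (A : Type) (a0 : A) (f : E -> A) : pw_constant Th f ->
  exists c : {set V} -> A, forall T x, T \in elements Th -> (hull T)° x -> f x = c T.
Proof.
move=> fc; suff /choice[c cP] : forall T, exists c : A, T \in elements Th ->
    forall x, (hull T)° x -> f x = c.
  by exists c => T x TTh; exact: cP.
move=> T; have [TTh|TTh] := boolP (T \in elements Th); last by exists a0.
by have [c cE] := fc T TTh; exists c.
Qed.

(** The mean of an affine function is its centroid value. [Pi_h] is some function satisfying the
    orthogonality relations: [w0] shows that one exists, and testing with the indicator of a single
    element fixes the value of any such function there. *)
Lemma Pi_h_pw_affine v l T x : pw_affine v l -> T \in elements Th ->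
  (hull T)° x -> Pi_h Omega Th v x = affine (l T) (centroid T (pos Th)).
Proof.
move=> vl TTh Tx; pose m T := affine (l T) (centroid T (pos Th)).
have disj T1 T2 z : T1 \in elements Th -> T2 \in elements Th ->
    (hull T1)° z -> (hull T2)° z -> T1 = T2.
  move=> h1 h2 z1 z2; apply/eqP; apply: contraT => T12.
  by have : ((hull T1)° `&` (hull T2)°) z by []; rewrite (element_interior_disjoint hTh LP).
have intE (w c : E -> R) (wT cT : {set V} -> R) :
    (forall T x, T \in elements Th -> (hull T)° x -> w x = wT T) ->
    (forall T x, T \in elements Th -> (hull T)° x -> c x = cT T) ->
    \int[mu]_(x in Omega) ((v x - w x) * c x) =
    \sum_(T in elements Th) (m T - wT T) * cT T * volume T.
  move=> wE cE; rewrite /Rintegral.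
  rewrite (@integral_mesh_affine R d hd Omega hOmega Th hTh L LP _
    (fun T => (cT T *: (l T).1, ((l T).2 - wT T) * cT T))) /=; last first.
    by move=> U z UTh Uz; rewrite (vl U)// (wE U)// (cE U)// /affine /= dotZl; ring.
  by apply: eq_bigr => U _; congr (_ * _); rewrite /m /affine /= dotZl; ring.
pose w0 z := \sum_(U in elements Th) if `[< (hull U)° z >] then m U else 0.
have w0E U z : U \in elements Th -> (hull U)° z -> w0 z = m U.
  move=> UTh Uz; rewrite /w0 (bigD1 U)//= asboolT// big1 ?addr0// => W /andP[WTh WU].
  rewrite asboolF// => Wz; move/eqP: WU; apply; exact: disj WTh UTh Wz Uz.
have w0P : is_L2_projection Omega Th v w0.
  split; first by move=> U UTh; exists (m U) => z; exact: w0E.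
  move=> c /(pw_constant_choice 0)[cT cE].
  by rewrite (intE w0 c m cT)// big1// => U _; rewrite subrr !mul0r.
rewrite /Pi_h; case: xgetP => [w _ [wc wP]|/(_ _ w0P)//].
have [wT wE] := pw_constant_choice 0 wc.
pose c z : R := if `[< (hull T)° z >] then 1 else 0.
have cE U z : U \in elements Th -> (hull U)° z -> c z = (U == T)%:R.
  move=> UTh Uz; rewrite /c; case: asboolP => [Tz|Tz].
    by rewrite (disj U T z)// eqxx.
  by case: eqVneq => // UT; case: Tz; rewrite -UT.
have /wP : pw_constant Th c by move=> U UTh; exists (U == T)%:R => z; exact: cE.
rewrite (intE w c wT (fun U => (U == T)%:R))// (bigD1 T)//= eqxx mulr1 big1 ?addr0; last first.
  by move=> U /andP[_ /negPf ->]; rewrite mulr0 mul0r.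
move=> /eqP; rewrite mulf_eq0 [volume T == 0]gt_eqF ?(volume_gt0 LP)// orbF subr_eq0 => /eqP.
by rewrite /m => ->; exact: wE.
Qed.

Lemma Pi_h_vec_pw_affine y Y T x : pw_affine_field y Y -> T \in elements Th ->
  (hull T)° x -> Pi_h_vec Omega Th y x = affine_field (Y T) (centroid T (pos Th)).
Proof.
move=> yY TTh Tx; apply/rowP => i; rewrite !mxE.
apply: (@Pi_h_pw_affine _ (fun T => Y T i)) => // U z UTh Uz.
by rewrite (yY U z)// mxE.
Qed.
End discrete_spaces.

(** * Convex duality *)

Section duality.
Variable R : realType.
Local Open Scope ereal_scope.

Lemma fenchel_conjugate_gtNy (T : Type) (pairing : T -> T -> R) (f : T -> \bar R) s :
  Defs.proper f -> fenchel_conjugate pairing f s != -oo.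
Proof.
move=> [fNy [w fw]]; rewrite -ltNye.
apply: (@lt_le_trans _ _ ((pairing s w)%:E - f w)); last first.
  by apply: ereal_sup_ubound; exists w.
by move: (fNy w) fw; case: (f w) => //= r _ _; rewrite ltNyr.
Qed.

(** If [f x] is [+oo], the right-hand side is [+oo] only because properness keeps the conjugate away
    from [-oo]. *)
Lemma fenchel_young (T : Type) (pairing : T -> T -> R) (f : T -> \bar R) s x :
  Defs.proper f -> (pairing s x)%:E <= fenchel_conjugate pairing f s + f x.
Proof.
move=> fP; have [fNy _] := fP; have [fx|] := boolP (f x \is a fin_num).
  by rewrite -leeBlDr//; apply: ereal_sup_ubound; exists x.
rewrite fin_numE fNy/= negbK => /eqP ->.
by rewrite addey ?leey// fenchel_conjugate_gtNy.
Qed.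

Section saddle.
Variables (X Y : Type) (A : set X) (B : set Y) (F G : X -> \bar R)
  (Fs Gs : Y -> \bar R) (b : X -> Y -> R) (u : X) (z : Y).
Hypotheses (FNy : forall x, A x -> F x != -oo) (GNy : forall x, A x -> G x != -oo).
Hypotheses (FsNy : forall y, B y -> Fs y != -oo) (GsNy : forall y, B y -> Gs y != -oo).
Hypotheses (Au : A u) (Bz : B z).
Hypothesis Fsup : F u = ereal_sup [set (b u y)%:E - Fs y | y in B].
Hypothesis Gsup : Gs z = ereal_sup [set (- b v z)%:E - G v | v in A].

Let Fle y : B y -> (b u y)%:E - Fs y <= F u.
Proof. by move=> By; rewrite Fsup; apply: ereal_sup_ubound; exists y. Qed.

Let Gle v : A v -> (- b v z)%:E - G v <= Gs z.
Proof. by move=> Av; rewrite Gsup; apply: ereal_sup_ubound; exists v. Qed.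

(** The left side is not [-oo] and the right side not [+oo], so all four terms are finite. Two
    Fenchel inequalities whose sum is an equality are then equalities themselves. *)
Lemma duality_equality : F u + G u = - Fs z - Gs z ->
  exists p q r s : R, [/\ [/\ F u = p%:E, G u = q%:E, Fs z = r%:E & Gs z = s%:E],
    (b u z = p + r)%R & (- b u z = q + s)%R].
Proof.
move: (Fle Bz) (Gle Au) (FNy Au) (GNy Au) (FsNy Bz) (GsNy Bz).
case: (F u) => [p||]//; case: (G u) => [q||]//; case: (Fs z) => [r||]//;
  case: (Gs z) => [s||]//; move=> h1 h2 _ _ _ _ // [h].
exists p, q, r, s; move: h1 h2; rewrite -!EFinB !lee_fin => h1 h2.
by split; [split|lra|lra].
Qed.

(** The first inequality of the saddle point says that [z] attains the supremum giving [F u], the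
    second that [u] attains the one giving [Gs z]; adding the two values cancels [b u z]. *)
Lemma duality_saddle : F u + G u = - Fs z - Gs z <->
  (forall y, B y -> (b u y)%:E - Fs y + G u <= (b u z)%:E - Fs z + G u) /\
  (forall v, A v -> (b u z)%:E - Fs z + G u <= (b v z)%:E - Fs z + G v).
Proof.
split.
  move=> /duality_equality[p [q [r [s [[Fu Gu Fz Gz] bp bq]]]]].
  rewrite Gu Fz; split => [y By|v Av].
    apply: leeD2r; apply: le_trans (Fle By) _.
    by rewrite Fu -EFinB lee_fin; lra.
  have := Gle Av; have := GNy Av; rewrite Gz.
  case: (G v) => [t||]// _; last by rewrite leey.
  by rewrite -!EFinB -!EFinD !lee_fin; lra.
move=> [h1 h2].
have [y0 By0 y0fin] : exists2 y, B y & Fs y < +oo.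
  apply: contrapT => /forall2NP h; move/eqP: (FNy Au); apply.
  apply/eqP; rewrite -leeNy_eq Fsup; apply: ge_ereal_sup => _ [y By <-].
  by have [//|/negP] := h y; rewrite -leNgt leye_eq => /eqP ->.
have [v0 Av0 v0fin] : exists2 v, A v & G v < +oo.
  apply: contrapT => /forall2NP h; move/eqP: (GsNy Bz); apply.
  apply/eqP; rewrite -leeNy_eq Gsup; apply: ge_ereal_sup => _ [v Av <-].
  by have [//|/negP] := h v; rewrite -leNgt leye_eq => /eqP ->.
(* [Fs z = +oo] would make the middle value [-oo], below that at [y0]; [G u = +oo] with [Fs z]
   finite would make it [+oo], above that at [v0]. *)
have := h1 _ By0; have := h2 _ Av0.
move: (GNy Au) (GNy Av0) v0fin (FsNy By0) y0fin (FsNy Bz) (FNy Au) (GsNy Bz).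
case Gu : (G u) => [q||]//; case: (G v0) => [q0||]//; case: (Fs y0) => [r0||]//;
  case Fz : (Fs z) => [r||]//;
  rewrite -?EFinB -?EFinD ?lee_fin //= => _ _ _ _ _ _ FuNy GzNy _ _.
have FuE : F u = (b u z - r)%:E.
  apply/eqP; rewrite eq_le; apply/andP; split.
    rewrite Fsup; apply: ge_ereal_sup => _ [y By <-].
    by have := h1 _ By; rewrite Gu Fz leeD2rE.
  by have := Fle Bz; rewrite Fz.
have GzE : Gs z = (- b u z - q)%:E.
  apply/eqP; rewrite eq_le; apply/andP; split.
    rewrite Gsup; apply: ge_ereal_sup => _ [v Av <-].
    have := h2 _ Av; rewrite Gu Fz; have := GNy Av.
    case: (G v) => [t||]// _; last by rewrite leNye.
    by rewrite -!EFinB -!EFinD !lee_fin; lra.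
  by have := Gle Au; rewrite Gu.
by rewrite FuE GzE -!EFinN -!EFinD; congr EFin; ring.
Qed.
End saddle.

Section weighted_sums.
Variables (I : finType) (P : pred I) (m : I -> R).
Hypothesis m0 : forall i, P i -> (0 < m i)%R.

Lemma weighted_sum_neqNy (f : I -> \bar R) : (forall i, P i -> f i != -oo) ->
  \sum_(i | P i) f i * (m i)%:E != -oo.
Proof.
move=> fNy; apply/eqP => /esum_eqNyP[i [_ Pi]].
have := fNy i Pi; case: (f i) => [r||]// _.
by rewrite gt0_mulye// lte_fin m0.
Qed.

Lemma weighted_sum_fin (f : I -> \bar R) :
  \sum_(i | P i) f i * (m i)%:E \is a fin_num ->
  forall i, P i -> f i \is a fin_num.
Proof.
move=> /sum_fin_numP h i Pi; have := h i (mem_index_enum i) Pi.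
have mi : 0 < (m i)%:E by rewrite lte_fin m0.
by case: (f i) => [r||]//; rewrite ?gt0_mulye ?gt0_mulNye.
Qed.

(** The defects [f i + g i - h i] are nonnegative and their sum with positive weights is zero, so
    each vanishes. This localises the integrated Fenchel equality to elements. *)
Lemma weighted_sum_equality (f g : I -> \bar R) (h : I -> R) :
  (forall i, P i -> (h i)%:E <= f i + g i) ->
  \sum_(i | P i) f i * (m i)%:E \is a fin_num ->
  \sum_(i | P i) g i * (m i)%:E \is a fin_num ->
  \sum_(i | P i) f i * (m i)%:E + \sum_(i | P i) g i * (m i)%:E =
    (\sum_(i | P i) h i * m i)%R%:E ->
  forall i, P i -> (h i)%:E = f i + g i.
Proof.
move=> hfg ff gf; have fF := weighted_sum_fin ff; have gF := weighted_sum_fin gf.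
have E k : (forall i, P i -> k i \is a fin_num) ->
    \sum_(i | P i) k i * (m i)%:E = (\sum_(i | P i) fine (k i) * m i)%R%:E.
  by move=> kF; rewrite -sumEFin; apply: eq_bigr => i Pi; rewrite EFinM fineK// kF.
rewrite !E// -EFinD => -[e] i Pi.
have : (\sum_(i | P i) (fine (f i) + fine (g i) - h i) * m i = 0)%R.
  under eq_bigr do rewrite mulrBl mulrDl.
  by rewrite sumrB big_split /= e subrr.
move=> /psumr_eq0P s0.
have /eqP : ((fine (f i) + fine (g i) - h i) * m i = 0)%R.
  apply: s0 => // j Pj; apply: mulr_ge0; last exact/ltW/m0.
  by rewrite subr_ge0 -lee_fin EFinD !fineK ?fF ?gF// hfg.
rewrite mulf_eq0 (gt_eqF (m0 Pi)) orbF subr_eq0 => /eqP <-.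
by rewrite EFinD !fineK ?fF ?gF.
Qed.
End weighted_sums.
End duality.

(** * The equivalence and the pointwise optimality relations *)

Unset Implicit Arguments.
Local Open Scope ereal_scope.

Theorem proposition2p1 (R : realType) (d : nat) (hd : (0 < d)%N)
    (Omega : set 'rV[R]_d) (hOmega : polyhedral_lipschitz_domain Omega)
    (Th : mesh R d) (hTh : conforming_triangulation Omega Th)
    (kappa : R) (hkappa : shape_regular Th kappa)
    (GammaD GammaN : set 'rV[R]_d)
    (hGamma : boundary_partition Omega Th GammaD GammaN)
    (phi : 'rV[R]_d -> \bar R) (hphi : proper_convex_lsc phi)
    (psi : 'rV[R]_d -> R -> \bar R)
    (hpsi_pw : forall t : R, pw_constant Th (fun x => psi x t))
    (hpsi : {ae lebesgue_rV d, forall x, Omega x ->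
               proper_convex_lsc (psi x : R^o -> \bar R)})
    (hmin : exists2 w, crouzeix_raviart Omega Th GammaD w &
              forall v, crouzeix_raviart Omega Th GammaD v ->
                I_cr Omega Th phi psi w <= I_cr Omega Th phi psi v)
    (u : 'rV[R]_d -> R) (hu : crouzeix_raviart Omega Th GammaD u)
    (z : 'rV[R]_d -> 'rV[R]_d) (hz : raviart_thomas Omega Th GammaN z)
    (hphi_u : \int[lebesgue_rV d]_(x in Omega) phi (grad u x) =
      ereal_sup
        [set (\int[lebesgue_rV d]_(x in Omega)
                (dot (grad u x) (Pi_h_vec Omega Th y x))%:E) -
             (\int[lebesgue_rV d]_(x in Omega)
                phi_conj phi (Pi_h_vec Omega Th y x))
        | y in raviart_thomas Omega Th GammaN])
    (hpsi_z :
      \int[lebesgue_rV d]_(x in Omega) psi_conj psi x (divergence z x) =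
      ereal_sup
        [set (\int[lebesgue_rV d]_(x in Omega)
                (divergence z x * Pi_h Omega Th v x)%:E) -
             (\int[lebesgue_rV d]_(x in Omega) psi x (Pi_h Omega Th v x))
        | v in crouzeix_raviart Omega Th GammaD]) :
  let i := I_cr Omega Th phi psi u = D_rt Omega Th phi psi z in
  let ii := saddle_point (Pi_h Omega Th @` crouzeix_raviart Omega Th GammaD)
              (raviart_thomas Omega Th GammaN)
              (L_bar Omega Th phi psi) (Pi_h Omega Th u) z in
  (i <-> ii) /\
  (i \/ ii -> {ae lebesgue_rV d, forall x, Omega x ->
     (dot (Pi_h_vec Omega Th z x) (grad u x))%:E =
       phi_conj phi (Pi_h_vec Omega Th z x) + phi (grad u x) /\
     (divergence z x * Pi_h Omega Th u x)%:E =
       psi_conj psi x (divergence z x) + psi x (Pi_h Omega Th u x)}).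
Proof.
have [L LP] := mesh_barycentric hTh.
pose CR := crouzeix_raviart Omega Th GammaD.
pose RT := raviart_thomas Omega Th GammaN.
have /choice[l lP] : forall v, exists l, CR v -> @pw_affine R d Th v l.
  move=> v; have [[vP _ _]|nv] := pselect (CR v); last by exists (fun=> (0%R, 0%R)).
  by have [l lP] := pw_polynomial1_affine vP; exists l.
have /choice[Y YP] : forall y, exists Y, RT y -> @pw_affine_field R d Th y Y.
  move=> y; have [[yP _ _ _]|ny] := pselect (RT y); last by exists (fun _ _ => (0%R, 0%R)).
  by have [Y YP] := pw_polynomial1_affine_field yP; exists Y.
pose el := [pred T | T \in elements Th].
pose cent T := centroid T (pos Th).
have cent_int T : T \in elements Th -> ((@hull R d Th T)°)%classic (cent T).
  move=> TTh; rewrite /hull (interior_convex_hull (LP T TTh)) => v vT /=.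
  rewrite (bary_centroid (LP T TTh))// in_itv /= andbT invr_gt0 ltr0n.
  by rewrite (card_bary_gt0 (LP T TTh)).
have psiE T x : T \in elements Th -> ((@hull R d Th T)°)%classic x -> psi x = psi (cent T).
  move=> TTh Tx; apply/funext => t; have [c cE] := hpsi_pw t T TTh.
  by rewrite !cE//; exact: cent_int.
(* Properness is known only almost everywhere; an element interior has positive measure, so it
   contains a good point, and [psi] is the same at the centroid. *)
have psiP T : T \in elements Th -> Defs.proper (psi (cent T)).
  move=> TTh; have [N [mN N0 subN]] := hpsi.
  have [x Tx Nx] : exists2 x, ((@hull R d Th T)°)%classic x & ~ N x.
    apply: contrapT => /forall2NP h.
    have : lebesgue_rV d (hull T)°%classic <= lebesgue_rV d N.
      apply: le_measure; rewrite ?inE//; first exact: measurable_element LP _ TTh.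
      by move=> x Tx; have [//|/contrapT] := h x.
    rewrite N0 (volumeE LP TTh) lee_fin leNgt; apply/negP; rewrite negbK.
    exact: volume_gt0 LP _ TTh.
  have : Omega x -> proper_convex_lsc (psi x : R^o -> \bar R).
    by apply: contrapT => h; apply: Nx; exact: subN.
  move=> /(_ (element_interior_sub hOmega hTh TTh Tx))[+ _ _].
  by rewrite (psiE T x).
have m0 T : el T -> (0 < volume T)%R by move=> TTh; exact: volume_gt0 LP _ TTh.
pose g v T := (l v T).1.
pose w v T := affine (l v T) (cent T).
pose p y T := affine_field (Y y T) (cent T).
pose r y T : R := (\sum_i (Y y T i).1 ord0 i)%R.
pose F v := \int[lebesgue_rV d]_(x in Omega) phi (grad v x).
pose G v := \int[lebesgue_rV d]_(x in Omega) psi x (Pi_h Omega Th v x).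
pose Fs y := \int[lebesgue_rV d]_(x in Omega) phi_conj phi (Pi_h_vec Omega Th y x).
pose Gs y := \int[lebesgue_rV d]_(x in Omega) psi_conj psi x (divergence y x).
pose b v y := (\sum_(T | el T) dot (g v T) (p y T) * volume T)%R.
have intc := integral_mesh_constant hd hOmega hTh LP.
have gE v T x : CR v -> T \in elements Th ->
    ((@hull R d Th T)°)%classic x -> grad v x = g v T.
  by move=> /lP vl TTh Tx; exact: grad_pw_affine vl TTh Tx.
have wE v T x : CR v -> T \in elements Th -> ((@hull R d Th T)°)%classic x ->
    Pi_h Omega Th v x = w v T.
  by move=> /lP vl TTh Tx; exact: (Pi_h_pw_affine hd hOmega hTh LP vl TTh Tx).
have pE y T x : RT y -> T \in elements Th -> ((@hull R d Th T)°)%classic x ->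
    Pi_h_vec Omega Th y x = p y T.
  by move=> /YP yY TTh Tx; exact: (Pi_h_vec_pw_affine hd hOmega hTh LP yY TTh Tx).
have rE y T x : RT y -> T \in elements Th -> ((@hull R d Th T)°)%classic x ->
    divergence y x = r y T.
  by move=> /YP yY TTh Tx; exact: divergence_pw_affine yY TTh Tx.
have FE v : CR v -> F v = \sum_(T | el T) phi (g v T) * (volume T)%:E.
  by move=> hv; apply: intc => T x TTh Tx; rewrite (gE v T x).
have GE v : CR v -> G v = \sum_(T | el T) psi (cent T) (w v T) * (volume T)%:E.
  by move=> hv; apply: intc => T x TTh Tx; rewrite (wE v T x)// (psiE T x).
have FsE y : RT y -> Fs y = \sum_(T | el T) phi_conj phi (p y T) * (volume T)%:E.
  by move=> hy; apply: intc => T x TTh Tx; rewrite (pE y T x).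
have GsE y : RT y -> Gs y = \sum_(T | el T) psi_conj psi (cent T) (r y T) * (volume T)%:E.
  by move=> hy; apply: intc => T x TTh Tx; rewrite (rE y T x)// /psi_conj (psiE T x).
have bE v y : CR v -> RT y ->
    \int[lebesgue_rV d]_(x in Omega) (dot (grad v x) (Pi_h_vec Omega Th y x))%:E = (b v y)%:E.
  move=> hv hy; rewrite /b -sumEFin.
  rewrite (intc _ (fun T => (dot (g v T) (p y T))%:E)); last first.
    by move=> T x TTh Tx; rewrite (gE v T x)// (pE y T x).
  by apply: eq_bigr => T _; rewrite EFinM.
(* Discrete integration by parts: a single form [b] now serves both hypotheses and the
   Lagrangian. *)
have bdE v y : CR v -> RT y -> (\sum_(T | el T) r y T * w v T * volume T = - b v y)%R.
  move=> hv hy; apply/eqP; rewrite -addr_eq0 addrC -big_split /=.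
  have := discrete_integration_by_parts hd hOmega hTh LP hGamma hv (lP v hv) hy (YP y hy).
  move=> ibp; rewrite -[X in _ == X]ibp; apply/eqP; apply: eq_bigr => T _.
  by rewrite mulrDl [(r _ _ * _)%R]mulrC.
have bE' v y : CR v -> RT y ->
    \int[lebesgue_rV d]_(x in Omega) (divergence y x * Pi_h Omega Th v x)%:E = (- b v y)%:E.
  move=> hv hy; rewrite -bdE// -sumEFin.
  rewrite (intc _ (fun T => (r y T * w v T)%:E)); last first.
    by move=> T x TTh Tx; rewrite (rE y T x)// (wE v T x).
  by apply: eq_bigr => T _; rewrite EFinM.
have [phiP _ _] := hphi; have [phiNy _] := phiP.
have FNy v : CR v -> F v != -oo.
  by move=> hv; rewrite FE//; apply: (weighted_sum_neqNy m0).
have GNy v : CR v -> G v != -oo.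
  by move=> hv; rewrite GE//; apply: (weighted_sum_neqNy m0) => T /psiP[].
have FsNy y : RT y -> Fs y != -oo.
  move=> hy; rewrite FsE//; apply: (weighted_sum_neqNy m0) => T _.
  exact: fenchel_conjugate_gtNy.
have GsNy y : RT y -> Gs y != -oo.
  move=> hy; rewrite GsE//; apply: (weighted_sum_neqNy m0) => T TTh.
  by apply: fenchel_conjugate_gtNy; exact: psiP.
have Fsup : F u = ereal_sup [set (b u y)%:E - Fs y | y in RT]%classic.
  rewrite /F hphi_u; congr ereal_sup; apply/seteqP.
  by split => _ [y hy <-]; exists y => //; rewrite bE.
have Gsup : Gs z = ereal_sup [set (- b v z)%:E - G v | v in CR]%classic.
  rewrite /Gs hpsi_z; congr ereal_sup; apply/seteqP.
  by split => _ [v hv <-]; exists v => //; rewrite bE'.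
have LE v y : CR v -> RT y ->
    L_bar Omega Th phi psi (Pi_h Omega Th v) y = (b v y)%:E - Fs y + G v.
  by move=> hv hy; rewrite /L_bar bE'// EFinN oppeK.
move=> i ii.
have iE : i <-> F u + G u = - Fs z - Gs z by [].
have equiv : i <-> ii.
  rewrite iE (duality_saddle FNy GNy FsNy GsNy hu hz Fsup Gsup) /ii.
  split=> [[h1 h2]|[_ _ h1 h2]]; split.
  - by exists u.
  - exact: hz.
  - by move=> y hy; rewrite (LE u y hu hy) (LE u z hu hz); exact: h1.
  - by move=> _ [v hv <-]; rewrite (LE v z hv hz) (LE u z hu hz); exact: h2.
  - by move=> y hy; have := h1 y hy; rewrite (LE u y hu hy) (LE u z hu hz).
  - have h2' v : CR v -> L_bar Omega Th phi psi (Pi_h Omega Th u) z <=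
        L_bar Omega Th phi psi (Pi_h Omega Th v) z by move=> hv; apply: h2; exists v.
    by move=> v hv; have := h2' v hv; rewrite (LE v z hv hz) (LE u z hu hz).
split=> [|hii]; first exact: equiv.
have /(duality_equality FNy GNy FsNy GsNy hu hz Fsup Gsup) : F u + G u = - Fs z - Gs z.
  by apply/iE; case: hii => [//|/equiv].
move=> [fu [gu [fz [gz [[Fu Gu Fz Gz] bF bG]]]]].
(* The finite values and the split equalities [bF], [bG] say that the Fenchel inequalities are sharp
   after summation, hence on each element. *)
have eqF T : el T -> (dot (p z T) (g u T))%:E = phi_conj phi (p z T) + phi (g u T).
  apply: (@weighted_sum_equality R _ el _ m0 (fun T => phi_conj phi (p z T))
    (fun T => phi (g u T)) (fun T => dot (p z T) (g u T))).
  - by move=> U _; exact: fenchel_young.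
  - by rewrite -FsE// Fz.
  - by rewrite -FE// Fu.
  - rewrite -FsE// -FE// Fz Fu -EFinD addrC -bF; congr EFin.
    by apply: eq_bigr => U _; rewrite dotC.
have eqG T : el T -> (r z T * w u T)%:E =
    psi_conj psi (cent T) (r z T) + psi (cent T) (w u T).
  apply: (@weighted_sum_equality R _ el _ m0 (fun T => psi_conj psi (cent T) (r z T))
    (fun T => psi (cent T) (w u T)) (fun T => r z T * w u T)%R).
  - by move=> U UTh; apply: fenchel_young; exact: psiP.
  - by rewrite -GsE// Gz.
  - by rewrite -GE// Gu.
  - by rewrite -GsE// -GE// Gz Gu -EFinD addrC -bG bdE.
have [N [mN N0 ON]] := mesh_null_set hd hTh LP.
exists N; split => // x /= /not_implyP[Ox nx]; apply: contrapT => Nx; apply: nx.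
have [//|[T TTh Tx]] := ON x Ox.
rewrite (pE z T x)// (gE u T x)// (rE z T x)// (wE u T x)// /psi_conj (psiE T x)//.
by split; [exact: eqF|exact: eqG].
Qed.
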